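(* The VOA $U$ is generated by two conformal vectors $e$ and $f$ with central charge $1/2$ such that $\langle e,f\rangle=13/2^{10}$.
   Context: Everything is over $\mathbb C$. $L(c,h)$ is the irreducible highest weight Virasoro module with central charge $c$ and highest weight $h$. $W(0)=L(\frac45,0)\oplus L(\frac45,3)$ and $N(0)=L(\frac67,0)\oplus L(\frac67,5)$ denote the (unique) simple VOA structures on these spaces. $W(\frac23)^\pm$ are the two inequivalent irreducible $W(0)$-modules isomorphic to $L(\frac45,\frac23)$ over $L(\frac45,0)$, and $N(\frac43)^\pm$ are the two inequivalent irreducible $N(0)$-modules isomorphic to $L(\frac67,\frac43)$ over $L(\frac67,0)$. $U$ denotes the simple VOA, unique up to isomorphism, which is a $\mathbb Z_3$-graded extension $U=U^0\oplus U^1\oplus U^2$ of $U^0=W(0)\otimes N(0)$ (same vacuum and Virasoro vector, $Y(u,z)v\in U^{i+j}((z))$ for $u\in U^i,v\in U^j$) with $U^1=W(\frac23)^+\otimes N(\frac43)^+$ and $U^2=W(\frac23)^-\otimes N(\frac43)^-$. One has $U_0=\mathbb C\mathbf 1$ and $U_1=0$. A conformal vector with central charge $c$ in $U$ is a vector $x\in U_2$ whose modes $x_{(n+1)}$ satisfy the Virasoro algebra relations with central charge $c$. $\langle\cdot,\cdot\rangle$ is the invariant bilinear form on $U$ with $\langle\mathbf 1,\mathbf 1\rangle=1$; on $U_2$ it is given by $\langle x,y\rangle\mathbf 1=x_{(3)}y$. *)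

(* Defs.v *)
From HB Require Import structures.
From mathcomp Require Import all_boot all_order all_algebra sesquilinear.
From mathcomp Require Import all_classical reals.
From mathcomp Require Import complex.
Set Implicit Arguments.
Unset Strict Implicit.
Unset Printing Implicit Defensive.
Import GRing.Theory.
Local Open Scope classical_set_scope.
Local Open Scope ring_scope.

(* The base field is the field R[i] of complex numbers, R : realType.
   All infinite sums below are finitely supported sums (fsbigop): the vertex
   operator algebra and module axioms (truncation) make their supports finite. *)

Section Linear.
Variable K : fieldType.

Definition subspace (V : lmodType K) (P : set V) :=
  P 0 /\ forall (a : K) u v, P u -> P v -> P (a *: u + v).

Definition fin_dim (V : lmodType K) (P : set V) :=
  exists (n : nat) (b : 'I_n -> V),
    forall v, P v -> exists c : 'I_n -> K, v = \sum_(i < n) c i *: b i.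

Definition irreducible_under (I : Type) (V : lmodType K) (op : I -> V -> V) :=
  (exists v : V, v != 0) /\
  forall P : set V, subspace P -> (forall i v, P v -> P (op i v)) ->
    P = [set 0] \/ P = setT.

Definition internal_direct_sum (J : finType) (V : lmodType K)
    (G : J -> set V) :=
  [/\ forall j, subspace (G j),
      forall v, exists g : J -> V, (forall j, G j (g j)) /\ v = \sum_j g j
    & forall g : J -> V, (forall j, G j (g j)) -> \sum_j g j = 0 ->
        forall j, g j = 0].

Definition is_tensor_product (A B T : lmodType K) (t : {bilinear A -> B -> T}) :=
  forall (X : lmodType K) (f : {bilinear A -> B -> X}),
    exists g : {linear T -> X},
      (forall a b, g (t a b) = f a b) /\
      (forall g' : {linear T -> X},
         (forall a b, g' (t a b) = f a b) -> g' =1 g).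

(* binomial coefficient with integral upper argument *)
Definition zbin (m : int) (j : nat) : K :=
  (\prod_(i < j) (m - i%:Z)%:~R) / (j`!)%:R.

Definition virasoro_rel (c : K) (V : lmodType K) (L : int -> V -> V) :=
  forall (m n : int) (v : V),
    L m (L n v) - L n (L m v) =
      (m - n)%:~R *: L (m + n) v
      + (if m + n == 0 then ((m ^+ 3 - m)%:~R / 12 * c) *: v else 0).

(* The Virasoro module (V, L) is isomorphic to L(c,h); irreducibility makes the
   highest weight vector a generator. *)
Definition is_Lch (c h : K) (V : lmodType K) (L : int -> V -> V) :=
  [/\ forall n, linear (L n),
      virasoro_rel c L,
      irreducible_under L
    & exists v : V, [/\ v != 0, L 0 v = h *: v
                      & forall n : int, 0 < n -> L n v = 0]].

Definition is_Lch_sum (c1 h1 c2 h2 : K) (V : lmodType K) (L : int -> V -> V) :=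
  exists (M1 M2 : lmodType K) (L1 : int -> M1 -> M1) (L2 : int -> M2 -> M2),
    [/\ is_Lch c1 h1 L1, is_Lch c2 h2 L2
      & exists phi : {linear (M1 * M2)%type -> V}, bijective phi /\
          forall n x, phi (L1 n x.1, L2 n x.2) = L n (phi x)].

(* Y a n is the mode a_(n), where Y(a,z) = \sum_n a_(n) z^(-n-1); the identity
   is the coefficientwise form of the Jacobi identity. *)
Definition borcherds_identity (V M : lmodType K)
    (Y : V -> int -> V -> V) (YM : V -> int -> M -> M) :=
  forall (a b : V) (x : M) (m n k : int),
    \sum_(j \in [set: nat]) zbin m j *: YM (Y a (n + j%:Z) b) (m + k - j%:Z) x =
    \sum_(j \in [set: nat]) ((-1) ^+ j * zbin n j) *:
       (YM a (m + n - j%:Z) (YM b (k + j%:Z) x)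
        - (-1) ^ n *: YM b (n + k - j%:Z) (YM a (m + j%:Z) x)).

End Linear.

(* vmode n a b is a_(n) b. *)
Record voa (R : realType) := VOA {
  vcarrier :> lmodType R[i];
  vmode : int -> {bilinear vcarrier -> vcarrier -> vcarrier};
  vac : vcarrier;
  omega : vcarrier;
  vrank : R[i];
  voa_trunc : forall a b : vcarrier, exists n0 : int,
    forall n, n0 <= n -> vmode n a b = 0;
  voa_vac : forall (n : int) (b : vcarrier),
    vmode n vac b = if n == -1 then b else 0;
  voa_creation : forall a : vcarrier,
    vmode (-1) a vac = a /\ forall n : int, 0 <= n -> vmode n a vac = 0;
  voa_borcherds : borcherds_identity
    (fun a n b => vmode n a b) (fun a n b => vmode n a b);
  voa_virasoro : virasoro_rel vrank (fun n v => vmode (n + 1) omega v);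
  voa_derivative : forall (a b : vcarrier) (n : int),
    vmode n (vmode 0 omega a) b = (- n)%:~R *: vmode (n - 1) a b;
  voa_graded : forall v : vcarrier, exists s : seq vcarrier,
    v = \sum_(w <- s) w /\
    forall w, w \in s -> exists k : int, vmode 1 omega w = k%:~R *: w;
  voa_fin_dim : forall k : int,
    fin_dim [set v : vcarrier | vmode 1 omega v = k%:~R *: v];
  voa_bounded : exists k0 : int, forall k, k < k0 ->
    forall v : vcarrier, vmode 1 omega v = k%:~R *: v -> v = 0
}.

Section VOA.
Variable R : realType.
Implicit Types V U : voa R.

Definition virL V (n : int) (v : V) : V := vmode V (n + 1) (omega V) v.

(* the homogeneous space V_k, k the conformal weight *)
Definition weight V (k : int) : set V := [set v | virL 0 v = k%:~R *: v].

Definition voa_simple V :=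
  irreducible_under (fun (p : V * int) (v : V) => vmode V p.2 p.1 v).

Definition is_vertex_subalgebra V (P : set V) :=
  [/\ subspace P, P (vac V)
    & forall (n : int) u v, P u -> P v -> P (vmode V n u v)].

Definition generated_by V (S : set V) :=
  forall P : set V, is_vertex_subalgebra P -> S `<=` P -> P = setT.

Definition conformal_vector V (c : R[i]) (x : V) :=
  weight 2 x /\ virasoro_rel c (fun n v => vmode V (n + 1) x v).

(* <Y(a,z)u, v> = <u, Y(e^(z L(1)) (-z^(-2))^L(0) a, z^(-1)) v>, read off
   coefficientwise for a of weight k *)
Definition invariant_form V (B : {biscalar V}) :=
  forall (k n : int) (a u v : V), weight k a ->
    B (vmode V n a u) v =
      \sum_(i \in [set: nat]) (-1) ^ k / (i`!)%:R *
        B u (vmode V (2 * k - n - i%:Z - 2) (iter i (@virL V 1) a) v).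

(* <x,y> = s for the normalized invariant form, x and y of weight 2. The first
   clause is the formula <x,y> 1 = x_(3) y, which determines s even without
   appealing to the existence of the form. *)
Definition inner_product_is V (x y : V) (s : R[i]) :=
  vmode V 3 x y = s *: vac V /\
  forall B : {biscalar V}, invariant_form B -> B (vac V) (vac V) = 1 ->
    B x y = s.

End VOA.

Record vmodule (R : realType) (V : voa R) := VModule {
  mcarrier :> lmodType R[i];
  mmode : int -> {bilinear V -> mcarrier -> mcarrier};
  vmod_trunc : forall (a : V) (x : mcarrier), exists n0 : int,
    forall n, n0 <= n -> mmode n a x = 0;
  vmod_vac : forall (n : int) (x : mcarrier),
    mmode n (vac V) x = if n == -1 then x else 0;
  vmod_borcherds : borcherds_identity
    (fun a n b => vmode V n a b) (fun a n x => mmode n a x);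
  vmod_derivative : forall (a : V) (x : mcarrier) (n : int),
    mmode n (vmode V 0 (omega V) a) x = (- n)%:~R *: mmode (n - 1) a x;
  vmod_graded : forall x : mcarrier, exists s : seq mcarrier,
    x = \sum_(w <- s) w /\
    forall w, w \in s -> exists l : R[i], mmode 1 (omega V) w = l *: w;
  vmod_fin_dim : forall l : R[i],
    fin_dim [set x : mcarrier | mmode 1 (omega V) x = l *: x];
  vmod_bounded : forall l : R[i], exists k0 : int, forall k, k < k0 ->
    forall x : mcarrier, mmode 1 (omega V) x = (l + k%:~R) *: x -> x = 0
}.

Section Modules.
Variable R : realType.
Implicit Types V W N T U : voa R.

Definition mvirL V (M : vmodule V) (n : int) (x : M) : M :=
  mmode M (n + 1) (omega V) x.

Definition vmod_irreducible V (M : vmodule V) :=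
  irreducible_under (fun (p : V * int) (x : M) => mmode M p.2 p.1 x).

Definition vmod_isomorphic V (M M' : vmodule V) :=
  exists phi : {linear M -> M'}, bijective phi /\
    forall (a : V) (n : int) (x : M), phi (mmode M n a x) = mmode M' n a (phi x).

Definition is_W0 W := voa_simple W /\
  is_Lch_sum (4 / 5) 0 (4 / 5) 3 (@virL R W).

Definition is_N0 N := voa_simple N /\
  is_Lch_sum (6 / 7) 0 (6 / 7) 5 (@virL R N).

(* M1 and M2 are two inequivalent irreducible modules, both isomorphic to
   L(c,h) for the action of the Virasoro vector. *)
Definition is_module_pair (c h : R[i]) V (M1 M2 : vmodule V) :=
  [/\ vmod_irreducible M1 /\ is_Lch c h (@mvirL V M1),
      vmod_irreducible M2 /\ is_Lch c h (@mvirL V M2)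
    & ~ vmod_isomorphic M1 M2].

(* The VOA T is the tensor product of W and N, with pure tensors t a b. *)
Definition is_tensor_voa W N T (t : {bilinear W -> N -> T}) :=
  [/\ is_tensor_product t,
      t (vac W) (vac N) = vac T,
      t (omega W) (vac N) + t (vac W) (omega N) = omega T
    & forall (a a' : W) (b b' : N) (n : int),
        vmode T n (t a b) (t a' b') =
        \sum_(k \in [set: int]) t (vmode W k a a') (vmode N (n - 1 - k) b b')].

Definition is_tensor_module W N T (t : {bilinear W -> N -> T})
    (M : vmodule W) (P : vmodule N) (Q : vmodule T)
    (s : {bilinear M -> P -> Q}) :=
  is_tensor_product s /\
  forall (a : W) (b : N) (x : M) (y : P) (n : int),
    mmode Q n (t a b) (s x y) =
    \sum_(k \in [set: int]) s (mmode M k a x) (mmode P (n - 1 - k) b y).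

(* U is a Z_3-graded extension of T by the T-modules Q1 and Q2. *)
Definition is_Z3_extension T (Q1 Q2 : vmodule T) U :=
  exists (G : 'Z_3 -> set U) (i0 : {linear T -> U})
         (i1 : {linear Q1 -> U}) (i2 : {linear Q2 -> U}),
  [/\ internal_direct_sum G,
      forall (i j : 'Z_3) (n : int) (u v : U),
        G i u -> G j v -> G (i + j) (vmode U n u v),
      [/\ injective i0, injective i1 & injective i2],
      [/\ G 0 = range i0, G 1 = range i1 & G 2 = range i2]
    & [/\ i0 (vac T) = vac U,
          i0 (omega T) = omega U,
          forall (n : int) (a b : T),
            i0 (vmode T n a b) = vmode U n (i0 a) (i0 b),
          forall (n : int) (a : T) (x : Q1),
            i1 (mmode Q1 n a x) = vmode U n (i0 a) (i1 x)
        & forall (n : int) (a : T) (x : Q2),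
            i2 (mmode Q2 n a x) = vmode U n (i0 a) (i2 x)]].

End Modules.

(* Main.v *)
Require Import Defs.
From HB Require Import structures.
From mathcomp Require Import all_boot all_order all_algebra sesquilinear.
From mathcomp Require Import all_classical reals.
From mathcomp Require Import complex.
From mathcomp Require Import ring zify.
Set Implicit Arguments.
Unset Strict Implicit.
Unset Printing Implicit Defensive.
Import Order.TTheory GRing.Theory Num.Theory.
Local Open Scope classical_set_scope.
Local Open Scope ring_scope.

(** Let [o1], [o2] be the Virasoro vectors of [W(0)], [N(0)] and [u], [v] the
    highest weight vectors of [U^1], [U^2], of weight [2/3 + 4/3 = 2].  Since
    Virasoro words in the lowering modes span each piece, [U_1 = 0] and [U_2] is
    spanned by [o1, o2, u, v].  Simplicity of [U] forces [v_(3) u <> 0], say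
    [v_(3) u = 1], and Virasoro covariance gives [v_(1) u = 5/3 o1 + 28/9 o2];
    moreover [u_(1) u = la v] and [v_(1) v = mu u] for some scalars.
    The vector [u_(-1) u] lies in the second level of the Virasoro module
    generated by [v], so it is [la] times an explicit combination of five
    descendants of [v].  Applying [v_(3)] to it in two ways yields
    [la mu = 400/81], and after rescaling [la = mu = 20/9].  For [z^3 = 1] the
    vector [5/32 o1 + 7/16 o2 + 9/32 (z u + z^2 v)] is then conformal of central
    charge [1/2]; take [e], [f] for [z = 1] and for [z] a primitive cube root of
    unity.  The products of [e] and [f] recover [o1, o2, u, v], hence [U^1] and
    [U^2], and the span of [U^1], [U^2] and their products is an ideal. *)

(** Each Virasoro module is given only as irreducible with a highest weight vector, so words in the
    lowering modes are known to span but not to be independent. Coefficients are therefore read off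
    by applying raising modes until a multiple of one nonzero vector (the vacuum, [u] or [v])
    remains. Grading and covariance of the weight two products leave [la] and [mu] free. They get
    tied together by [v_(3) u_(-1) u], because the commutator formula for it also involves the
    pairing [v_(3) u]. Write the sought vector as p o1 + q o2 + r (z u + z^2 v). The condition x_(1)
    x = 2 x becomes p - p^2 = 5/3 r^2, q - q^2 = 28/9 r^2 and 4/3 p + 8/3 q + 20/9 r = 2, which p =
    5/32, q = 7/16, r = 9/32 satisfy. Multiplication by z^j on U^j is an automorphism of order three
    for z a primitive cube root of unity, and it carries e to f. Hence e and f differ only in the
    last term, and their inner product is (10 + 84 + 81 (z + z^2)) / 1024 = 13 / 1024. *)

Lemma fsbig_nat_trunc (V : zmodType) (F : nat -> V) (n : nat) :
  (forall j, (n <= j)%N -> F j = 0) ->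
  \sum_(j \in [set: nat]) F j = \sum_(j < n) F j.
Proof.
move=> F0; rewrite fsbig_ord; symmetry; apply: fsbig_widen => // j [_ /= nj].
by apply: F0; rewrite leqNgt; apply/negP.
Qed.

Lemma fsbig_single (V : zmodType) (T : choiceType) (F : T -> V) (i : T) :
  (forall j, j != i -> F j = 0) -> \sum_(j \in [set: T]) F j = F i.
Proof.
move=> F0; rewrite -[RHS](fsbig_set1 +%R i F); symmetry.
by apply: fsbig_widen => // j [_ /= ji]; apply: F0; apply/eqP.
Qed.

(** * Subspaces, spans and eigenvectors of a graded operator *)

Section Subspaces.
Variable K : fieldType.
Implicit Types V W : lmodType K.

Lemma subspace_comb V (P : set V) (a : K) u v :
  subspace P -> P u -> P v -> P (a *: u + v).
Proof. by case=> _; exact. Qed.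

Lemma subspaceZ V (P : set V) (a : K) u : subspace P -> P u -> P (a *: u).
Proof. by move=> [P0 Pl] Pu; rewrite -[_ *: _]addr0; apply: Pl. Qed.

Lemma subspaceD V (P : set V) u v : subspace P -> P u -> P v -> P (u + v).
Proof. by move=> [P0 Pl] Pu Pv; rewrite -[u]scale1r; apply: Pl. Qed.

Lemma subspaceN V (P : set V) u : subspace P -> P u -> P (- u).
Proof. by move=> sP Pu; rewrite -scaleN1r; apply: subspaceZ. Qed.

Lemma subspaceB V (P : set V) u v : subspace P -> P u -> P v -> P (u - v).
Proof. by move=> sP Pu Pv; apply: subspaceD => //; apply: subspaceN. Qed.

Lemma subspace_sum V (P : set V) (I : Type) (r : seq I) (Q : pred I) (F : I -> V) :
  subspace P -> (forall i, Q i -> P (F i)) -> P (\sum_(i <- r | Q i) F i).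
Proof.
move=> sP PF; elim/big_ind: _ => //; first by case: sP.
by move=> x y; apply: subspaceD.
Qed.

Lemma linear_fun0 V W (f : V -> W) : linear f -> f 0 = 0.
Proof. by move=> fl; move: (fl (-1) 0 0); rewrite !scaleN1r oppr0 addr0 addNr. Qed.

Lemma linear_funZ V W (f : V -> W) (a : K) u : linear f -> f (a *: u) = a *: f u.
Proof. by move=> fl; move: (fl a u 0); rewrite (linear_fun0 fl) !addr0. Qed.

Lemma linear_funD V W (f : V -> W) u v : linear f -> f (u + v) = f u + f v.
Proof. by move=> fl; move: (fl 1 u v); rewrite !scale1r. Qed.

Lemma subspace_preim V W (f : V -> W) (P : set W) :
  linear f -> subspace P -> subspace [set x | P (f x)].
Proof.
move=> fl [P0 Pl].
by split=> [|a u v /= Pu Pv]; rewrite /= ?(linear_fun0 fl) // fl; apply: Pl.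
Qed.

(** Defined as an intersection, so that a property of the span follows by exhibiting one subspace
    that contains the generators. *)
Definition lspan V (S : set V) : set V :=
  [set x | forall P : set V, subspace P -> S `<=` P -> P x].

Lemma lspan_subspace V (S : set V) : subspace (lspan S).
Proof.
split=> [P [P0 _] _ //|a u v Su Sv P sP SP].
by apply: subspace_comb => //; [apply: Su|apply: Sv].
Qed.

Lemma sub_lspan V (S : set V) : S `<=` lspan S.
Proof. by move=> x Sx P _; apply. Qed.

Lemma lspan_min V (S P : set V) : subspace P -> S `<=` P -> lspan S `<=` P.
Proof. by move=> sP SP x; apply. Qed.


End Subspaces.

Section SubspaceType.
Variables (K : fieldType) (V : lmodType K) (P : set V).

Definition subspace_mem of subspace P : {pred V} := fun y => `[< P y >].

(** The universal property in [is_tensor_product] ranges over module types, so a subspace must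
    become such a type before it can serve as a target. *)
Record subspace_type (sP : subspace P) :=
  SubspaceType { subspace_val : V; _ : subspace_val \in subspace_mem sP }.

Variable sP : subspace P.

Lemma subspace_mem_closed : GRing.subsemimod_closed (subspace_mem sP).
Proof.
split; first split; first by apply/asboolP; case: sP.
  by move=> u v /asboolP Pu /asboolP Pv; apply/asboolP; apply: subspaceD.
by move=> a u /asboolP Pu; apply/asboolP; apply: subspaceZ.
Qed.

HB.instance Definition _ := [isSub for @subspace_val sP].
HB.instance Definition _ := [Choice of subspace_type sP by <:].
HB.instance Definition _ :=
  GRing.SubChoice_isSubLmodule.Build K V (subspace_mem sP) (subspace_type sP)
    subspace_mem_closed.

End SubspaceType.

(* Corestrict t to the subspace: both the inclusion of the induced retraction
   and the identity extend t, so they agree. *)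
Lemma tensor_product_spanned (K : fieldType) (A B T : lmodType K)
    (t : {bilinear A -> B -> T}) (P : set T) :
  is_tensor_product t -> subspace P -> (forall a b, P (t a b)) -> forall x, P x.
Proof.
move=> ht sP Pt x.
have Pt' a b : t a b \in subspace_mem sP by apply/asboolP.
pose f a b : subspace_type sP := SubspaceType (Pt' a b).
have fl : bilinear_for *:%R *:%R f.
  split=> [b c u v|a c u v]; apply: val_inj.
    exact: linearPl.
  exact: linearPr.
pose fpack := bilinear_isBilinear.Build K A B (subspace_type sP) *:%R *:%R f fl.
pose fB : {bilinear A -> B -> subspace_type sP} := HB.pack f fpack.
have [g [gf _]] := ht _ fB.
have [g' [_ uniq]] := ht _ t.
have e1 : (\val : subspace_type sP -> T) \o g =1 g'.
  by apply: uniq => a b /=; rewrite gf.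
have e2 : (idfun : T -> T) =1 g' by apply: uniq.
have -> : x = val (g x) by move: (e1 x) (e2 x) => /= -> <-.
by case: (g x) => y /= /asboolP.
Qed.

Section GradedSpan.
Variables (K : fieldType) (V : lmodType K) (D : int -> set V).
Hypothesis D_subspace : forall z, subspace (D z).
Hypothesis D_neg : forall z w, z < 0 -> D z w -> w = 0.

Lemma graded_span_sum x : lspan (fun w => exists z, D z w) x ->
  exists (N : nat) (y : nat -> V), (forall k : nat, D k (y k)) /\ x = \sum_(k < N) y k.
Proof.
pose Q : set V := [set x | exists (N : nat) (y : nat -> V),
  (forall k : nat, D k (y k)) /\ x = \sum_(k < N) y k].
move=> xD; apply: (xD Q).
  split=> [|a u v [N [y [Dy ->]]] [M [t [Dt ->]]]].
    by exists 0%N, (fun=> 0); split=> [k|]; [case: (D_subspace k)|rewrite big_ord0].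
  have ext n m (f : nat -> V) : (n <= m)%N ->
      \sum_(k < n) f k = \sum_(k < m) (if (k < n)%N then f k else 0).
    by move=> nm; rewrite (big_ord_widen _ f nm) big_mkcond.
  exists (maxn N M), (fun k => a *: (if (k < N)%N then y k else 0)
                               + (if (k < M)%N then t k else 0)).
  split=> [k|].
    by apply: subspace_comb => //; case: ifP => // _; case: (D_subspace k).
  rewrite big_split /= -scaler_sumr (ext N (maxn N M)) ?leq_maxl //.
  by rewrite (ext M (maxn N M)) ?leq_maxr.
move=> w [[k|k] Dw]; last first.
  exists 0%N, (fun=> 0); rewrite big_ord0 (D_neg _ Dw) //.
  by split=> // j; case: (D_subspace j).
exists k.+1, (fun j => if j == k then w else 0); split=> [j|].
  by case: eqP => [->//|_]; case: (D_subspace j).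
by rewrite big_ord_recr /= eqxx big1 ?add0r // => i _; rewrite ltn_eqF.
Qed.

End GradedSpan.

Section EigenDecomposition.
Variables (K : fieldType) (V : lmodType K) (L : V -> V).
Hypothesis L_linear : linear L.

Let L0 : L 0 = 0.
Proof. exact: linear_fun0. Qed.

Let LD x y : L (x + y) = L x + L y.
Proof. exact: linear_funD. Qed.

Let LZ a x : L (a *: x) = a *: L x.
Proof. exact: linear_funZ. Qed.

Let Lsum (I : Type) (r : seq I) (Q : pred I) (F : I -> V) :
  L (\sum_(i <- r | Q i) F i) = \sum_(i <- r | Q i) L (F i).
Proof. by elim/big_ind2: _ => // x x' y y' <- <-. Qed.

(* Apply the product of the operators L - e k over all k with e k != l. *)
Lemma eigen_component (l : K) (e : nat -> K) (y : nat -> V) (N : nat) :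
  (forall k, L (y k) = e k *: y k) ->
  L (\sum_(k < N) y k) = l *: (\sum_(k < N) y k) ->
  \sum_(k < N) y k = \sum_(k < N | e k == l) y k.
Proof.
move=> Ly Lx.
pose z := \sum_(k < N | e k != l) y k.
have xE : \sum_(k < N) y k = \sum_(k < N | e k == l) y k + z.
  by rewrite (bigID (fun k : 'I_N => e k == l)).
suff z0 : z = 0 by rewrite xE z0 addr0.
have Lz : L z = l *: z.
  apply: (addrI (\sum_(k < N | e k == l) l *: y k)).
  rewrite -[in RHS]scaler_sumr -scalerDr -xE -Lx xE LD; congr (_ + _).
  by rewrite Lsum; apply: eq_bigr => k /eqP <-; rewrite Ly.
pose op (s : seq nat) (w : V) := foldr (fun k x => L x - e k *: x) w s.
have opE s a w : L w = a *: w -> op s w = (\prod_(k <- s) (a - e k)) *: w.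
  move=> Lw; elim: s => [|k s IH] /=; first by rewrite big_nil scale1r.
  by rewrite IH big_cons LZ Lw !scalerA -scalerBl; congr (_ *: _); ring.
have op_sum s (Q : pred 'I_N) :
    op s (\sum_(k < N | Q k) y k) = \sum_(k < N | Q k) op s (y k).
  elim: s => //= k s ->; rewrite Lsum scaler_sumr -sumrB.
  by apply: eq_bigr.
pose s := [seq k <- iota 0 N | e k != l].
have : op s z = 0.
  rewrite op_sum big1 // => k ek; rewrite (opE _ (e k)) //.
  have ks : nat_of_ord k \in s by rewrite mem_filter ek mem_iota /=.
  by rewrite (big_rem _ ks) /= subrr mul0r scale0r.
rewrite (opE _ l) // => /eqP; rewrite scaler_eq0 => /orP[|/eqP //].
rewrite prodf_seq_eq0 => /hasP[k]; rewrite mem_filter => /andP[ek _] /=.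
by rewrite subr_eq0 eq_sym (negbTE ek).
Qed.

Variables (D : int -> set V) (e : int -> K).
Hypothesis D_subspace : forall z, subspace (D z).
Hypothesis D_neg : forall z w, z < 0 -> D z w -> w = 0.
Hypothesis D_eigen : forall z w, D z w -> L w = e z *: w.
Hypothesis e_inj : injective e.

(** By [eigen_component] only the components with eigenvalue [e z] survive, and injectivity of [e]
    leaves the single degree [z]. This turns an eigenvalue condition into membership in a graded
    piece. *)
Lemma graded_eigen z x : lspan (fun w => exists z, D z w) x ->
  L x = e z *: x -> D z x.
Proof.
move=> /(graded_span_sum D_subspace D_neg) [N [y [Dy ->]]] Lx.
rewrite (@eigen_component (e z) (fun k : nat => e k)) //.
  by apply: subspace_sum => // k /eqP /e_inj <-.
by move=> k; apply: D_eigen.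
Qed.

Lemma positive_span_eigen x : lspan (fun w => exists z : int, 0 < z /\ D z w) x ->
  L x = e 0 *: x -> x = 0.
Proof.
(* Truncating the grading to zero outside positive degrees makes the decomposition lemma applicable;
   the component with eigenvalue [e 0] is then zero. *)
move=> xpos Lx; pose D' (z : int) : set V := if 0 < z then D z else [set 0].
have : lspan (fun w => exists z, D' z w) x.
  move: xpos; apply: lspan_min; first exact: lspan_subspace.
  by move=> y [z [z0 Dz]]; apply: sub_lspan; exists z; rewrite /D' z0.
case/graded_span_sum => [z|z y z0|N [y [Dy xE]]].
- rewrite /D'; case: ifP => // _; split=> // b u v /= -> ->.
  by rewrite scaler0 addr0.
- by rewrite /D' ltNge (ltW z0).
rewrite xE (@eigen_component (e 0) (fun k : nat => e k)).
- rewrite big1 // => k /eqP /e_inj k0; have := Dy k.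
  by rewrite k0 /D' ltxx.
- move=> k; apply: D_eigen; have := Dy k; rewrite /D'; case: ifP => // _ /= ->.
  by case: (D_subspace k).
- by rewrite -xE.
Qed.

(** The functional is the projection onto the degree zero line along the span [H] of the positive
    degrees. It is well defined because [H] meets that line in 0, and its linearity follows from the
    uniqueness of the coefficient. *)
Lemma graded_coordinate (w : V) : w != 0 ->
  (forall x, D 0 x -> exists a, x = a *: w) -> D 0 w ->
  (forall x, lspan (fun w => exists z, D z w) x) ->
  exists f : V -> K, f w = 1 /\ forall a u v, f (a *: u + v) = a * f u + f v.
Proof.
move=> w0 D0w Dw all.
pose H := lspan (fun x => exists z : int, 0 < z /\ D z x).
have Hs : subspace H by apply: lspan_subspace.
have exists_c x : exists c, H (x - c *: w).
  apply: (all x [set x | exists c, H (x - c *: w)]).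
    split=> [|a u v [c Hc] [d Hd]]; first by exists 0; rewrite scale0r subrr; case: Hs.
    exists (a * c + d); rewrite scalerDl opprD addrACA -scalerA -scalerBr.
    exact: (subspace_comb a Hs Hc Hd).
  move=> y [z Dz]; have [z0|z0|z0] := ltgtP z 0.
  - by exists 0; rewrite scale0r subr0 (D_neg _ Dz) //; case: Hs.
  - by exists 0; rewrite scale0r subr0; apply: sub_lspan; exists z.
  - by subst z; have [a ->] := D0w _ Dz; exists a; rewrite subrr; case: Hs.
have Hw a : H (a *: w) -> a = 0.
  move=> Ha; have : a *: w = 0.
    apply: positive_span_eigen => //; apply: D_eigen.
    exact: (subspaceZ _ (D_subspace 0)).
  by move/eqP; rewrite scaler_eq0 (negbTE w0) orbF => /eqP.
have uniq_c x c d : H (x - c *: w) -> H (x - d *: w) -> c = d.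
  move=> Hc Hd; apply/eqP; rewrite -subr_eq0; apply/eqP/Hw.
  have -> : (c - d) *: w = (x - d *: w) - (x - c *: w).
    by rewrite scalerBl opprB [RHS]addrC addrA subrK.
  exact: (subspaceB Hs).
have [f Hf] := choice exists_c.
exists f; split.
  by apply: (uniq_c w) => //; rewrite scale1r subrr; case: Hs.
move=> a u v; apply: (uniq_c (a *: u + v)) => //.
by rewrite scalerDl opprD addrACA -scalerA -scalerBr; apply: (subspace_comb a Hs).
Qed.
End EigenDecomposition.

(** * Mode identities in a vertex operator algebra *)

Section Zbin.
Variable K : numFieldType.

Lemma zbin_nat (m j : nat) : zbin K m j = 'C(m, j)%:R.
Proof.
rewrite /zbin; have jf : (j`!%:R : K) != 0 by rewrite pnatr_eq0 -lt0n fact_gt0.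
apply: (mulIf jf); rewrite divfK // -natrM bin_ffact.
have [jm|mj] := leqP j m; last first.
  by rewrite ffact_small // (bigD1 (Ordinal mj)) //= subrr mulr0z mul0r.
rewrite ffact_prod natr_prod; apply: eq_bigr => i _.
by rewrite natrB ?rmorphB //= ltnW // (leq_trans (ltn_ord i)).
Qed.

Lemma zbin0 (m : int) : zbin K m 0 = 1.
Proof. by rewrite /zbin big_ord0 fact0 divr1. Qed.

Lemma zbin1 (m : int) : zbin K m 1 = m%:~R.
Proof. by rewrite /zbin big_ord1 subr0 divr1. Qed.

Lemma zbinN1 (j : nat) : zbin K (-1) j = (-1) ^+ j.
Proof.
rewrite /zbin; have jf : (j`!%:R : K) != 0 by rewrite pnatr_eq0 -lt0n fact_gt0.
apply: (mulIf jf); rewrite divfK //; elim: j {jf} => [|j IH].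
  by rewrite big_ord0 mul1r.
rewrite big_ord_recr /= IH factS exprS natrM.
have -> : (-1 - j%:Z)%:~R = - (j.+1)%:R :> K by rewrite -opprD mulrNz -PoszD add1n.
by ring.
Qed.

End Zbin.

Notation "a '_{' n '}' b" := (vmode _ n a b)
  (at level 35, right associativity, n at level 99, format "a '_{' n '}'  b").

Section Modes.
Variables (R : realType) (V : voa R).
Implicit Types (a b x y : V) (m n k : int).

(** The Borcherds identity at [n = 0]: only the term [j = 0] survives on the right. In
    [mode_comm_nat] the binomial coefficients, rather than the vanishing of products, cut off the
    left side. *)
Lemma mode_comm (N : nat) a b x m k :
  (forall j : nat, (N <= j)%N -> a _{j%:Z} b = 0) ->
  a _{m} (b _{k} x) - b _{k} (a _{m} x) =
  \sum_(j < N) zbin _ m j *: (a _{j%:Z} b) _{m + k - j%:Z} x.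
Proof.
move=> aN; have := voa_borcherds a b x m 0 k.
rewrite (@fsbig_nat_trunc _ _ N) => [|j Nj]; last first.
  by rewrite add0r aN // linear0l scaler0.
rewrite (@fsbig_single _ _ _ 0%N); last first.
  by case=> // j _; rewrite (zbin_nat _ 0) mulr0 scale0r.
rewrite zbin0 mul1r expr0z !scale1r !addr0 add0r => <-.
by apply: eq_bigr => j _; rewrite add0r.
Qed.

Lemma mode_comm_nat (m : nat) a b x k :
  a _{m%:Z} (b _{k} x) - b _{k} (a _{m%:Z} x) =
  \sum_(j < m.+1) 'C(m, j)%:R *: (a _{j%:Z} b) _{m%:Z + k - j%:Z} x.
Proof.
have := voa_borcherds a b x m 0 k.
rewrite (@fsbig_nat_trunc _ _ m.+1) => [|j mj]; last first.
  by rewrite zbin_nat bin_small // scale0r.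
rewrite (@fsbig_single _ _ _ 0%N); last first.
  by case=> // j _; rewrite (zbin_nat _ 0) mulr0 scale0r.
rewrite zbin0 mul1r expr0z !scale1r !addr0 add0r => <-.
by apply: eq_bigr => j _; rewrite add0r zbin_nat.
Qed.

Lemma mode_assoc (N : nat) a b x n k :
  (forall j : nat, (N <= j)%N -> b _{k + j%:Z} x = 0) ->
  (forall j : nat, (N <= j)%N -> a _{j%:Z} x = 0) ->
  (a _{n} b) _{k} x =
  \sum_(j < N) ((-1) ^+ j * zbin _ n j) *:
    (a _{n - j%:Z} (b _{k + j%:Z} x) - (-1) ^ n *: b _{n + k - j%:Z} (a _{j%:Z} x)).
Proof.
move=> bN aN; have := voa_borcherds a b x 0 n k.
rewrite (@fsbig_single _ _ _ 0%N); last first.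
  by case=> // j _; rewrite (zbin_nat _ 0) scale0r.
rewrite zbin0 scale1r !addr0 add0r => ->.
rewrite (@fsbig_nat_trunc _ _ N) => [|j Nj]; last first.
  by rewrite !add0r bN // aN // !linear0r scaler0 subrr scaler0.
by apply: eq_bigr => j _; rewrite !add0r.
Qed.

(** Skew-symmetry is the Borcherds identity at [m = -1], [k = 0] applied to the vacuum: the creation
    property kills everything on the right except [b _{n} a]. *)
Lemma mode_skew (N : nat) a b n :
  (forall j : nat, (N <= j)%N -> a _{n + j%:Z} b = 0) ->
  b _{n} a = - (-1) ^ n *: \sum_(j < N)
    (-1) ^+ j *: (a _{n + j%:Z} b) _{-1 - j%:Z} (vac V).
Proof.
move=> aN; have := voa_borcherds a b (vac V) (-1) n 0.
rewrite (@fsbig_nat_trunc _ _ N) => [|j Nj]; last first.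
  by rewrite aN // linear0l scaler0.
rewrite (@fsbig_single _ _ _ 0%N); last first.
  case=> // j _; rewrite (voa_creation b).2 // (voa_creation a).2; last by lia.
  by rewrite !linear0r scaler0 subrr scaler0.
rewrite zbin0 mul1r scale1r !addr0 (voa_creation b).2 // linear0r sub0r.
rewrite (voa_creation a).1.
under eq_bigr => j _ do rewrite zbinN1.
move=> ->; rewrite scalerN scaleNr opprK scalerA -expfzMl mulrNN mulr1 exp1rz.
by rewrite scale1r.
Qed.

Lemma mode_translate x : x _{-2} vac V = omega V _{0} x.
Proof.
have := voa_derivative x (vac V) (-1).
by rewrite (voa_creation _).1 opprK scale1r => ->.
Qed.

Lemma mode_truncN a b n0 : exists N : nat, forall j : nat, (N <= j)%N ->
  a _{n0 + j%:Z} b = 0.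
Proof.
have [n1 Hn] := voa_trunc a b; exists (absz (n1 - n0)) => j Nj; apply: Hn; lia.
Qed.

(* For m large enough that a _{m + j} x = 0 for all j, the Borcherds identity
   rewrites a _{p} c _{q} x modulo the terms a _{p - j} c _{q + j} x, j > 0. *)
Lemma mode_product_span a c x p q :
  lspan (fun w => exists b n, w = b _{n} x) (a _{p} (c _{q} x)).
Proof.
set S := lspan _; have sS : subspace S by apply: lspan_subspace.
have [M HM] := mode_truncN a x 0.
have [N HN] := mode_truncN c x q.
move: p; elim: N q HN => [|N IH] q HN p.
  by have := HN 0%N isT; rewrite addr0 => ->; rewrite linear0r; case: sS.
pose n := p - M%:Z.
have [N1 HN1] := mode_truncN a c n.
have := voa_borcherds a c x M%:Z n q.
rewrite (@fsbig_nat_trunc _ _ N1) => [|j Nj]; last first.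
  by rewrite HN1 // linear0l scaler0.
rewrite (@fsbig_nat_trunc _ _ N.+1) => [|j Nj]; last first.
  have -> : M%:Z + j%:Z = 0 + (M + j)%N%:Z :> int by rewrite PoszD; lia.
  by rewrite HN // HM ?leq_addr // !linear0r scaler0 subrr scaler0.
rewrite big_ord_recl expr0 zbin0 mul1r scale1r !addr0.
have -> : M%:Z + n = p by rewrite /n; lia.
have -> : a _{M%:Z} x = 0 by have := HM M (leqnn _); rewrite add0r.
rewrite linear0r scaler0 subr0 => /esym /(canRL (addrK _)) ->.
apply: (subspaceB sS).
  apply: subspace_sum => // j _; apply: (subspaceZ _ sS).
  by apply: sub_lspan; do 2 eexists.
apply: subspace_sum => // j _; apply: (subspaceZ _ sS); rewrite lift0.
have -> : M%:Z + j.+1%:Z = 0 + (M + j.+1)%N%:Z :> int by rewrite PoszD; lia.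
rewrite HM ?leq_addr // linear0r scaler0 subr0; apply: IH => i Ni.
have -> : q + j.+1%:Z + i%:Z = q + (j.+1 + i)%N%:Z by rewrite PoszD; lia.
by apply: HN; lia.
Qed.

End Modes.

(** * Spans of Virasoro descendants *)

Section FiniteSpan.
Variables (K : fieldType) (V : lmodType K).

Definition fspan (s : seq V) : set V :=
  [set x | exists c : nat -> K, x = \sum_(k < size s) c k *: s`_k].

Lemma fspan_subspace s : subspace (fspan s).
Proof.
split; first by exists (fun=> 0); rewrite big1 // => k _; rewrite scale0r.
move=> a u v [c ->] [d ->]; exists (fun k => a * c k + d k).
rewrite scaler_sumr -big_split /=; apply: eq_bigr => k _.
by rewrite scalerDl scalerA.
Qed.

Lemma mem_fspan s x : x \in s -> fspan s x.
Proof.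
move=> xs; exists (fun k => (k == index x s)%:R).
have ix : (index x s < size s)%N by rewrite index_mem.
rewrite (bigD1 (Ordinal ix)) //= eqxx scale1r nth_index // big1 ?addr0 //.
by move=> k; rewrite -val_eqE /= => /negbTE ->; rewrite scale0r.
Qed.

Lemma fspan_min s (P : set V) :
  subspace P -> (forall x, x \in s -> P x) -> fspan s `<=` P.
Proof.
move=> sP Ps x [c ->]; apply: subspace_sum => // k _.
by apply: (subspaceZ _ sP); apply: Ps; apply: mem_nth.
Qed.

End FiniteSpan.

Section Descendants.
Variables (K : fieldType) (V : lmodType K) (I : Type) (L : I -> int -> V -> V).
Variable B : int -> V -> Prop.

(** Degrees are carried as an index and the words are in no normal order, so properties of graded
    pieces are proved by induction. The index set [I] allows two commuting Virasoro actions at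
    once. *)
Inductive descendant : int -> set V :=
| desc0 z : descendant z 0
| desc_comb z (a : K) u v :
    descendant z u -> descendant z v -> descendant z (a *: u + v)
| desc_base z v : B z v -> descendant z v
| desc_step i z (m : int) v :
    0 < m -> descendant z v -> descendant (z + m) (L i (- m) v).

Lemma descendant_subspace z : subspace (descendant z).
Proof. by split; [apply: desc0|move=> a u v; apply: desc_comb]. Qed.

Hypothesis L_linear : forall i n, linear (L i n).
Hypothesis L_rel : forall i j m n v, exists a b : K,
  L i m (L j n v) = L j n (L i m v) + a *: L i (m + n) v
                    + (if m + n == 0 then b else 0) *: v.
Hypothesis B_ge0 : forall z v, B z v -> 0 <= z.
Hypothesis B_primary : forall z v i, B z v ->
  (exists h : K, L i 0 v = h *: v) /\ forall n, 0 < n -> L i n v = 0.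

Lemma descendant_neg z v : z < 0 -> descendant z v -> v = 0.
Proof.
move=> z0 D; elim: D z0 => {z v} //.
- by move=> z a u v _ IHu _ IHv z0; rewrite IHu // IHv // scaler0 addr0.
- by move=> z v /B_ge0; rewrite leNgt => /negP.
- move=> i z m v m0 _ IH zm; rewrite IH; last by lia.
  exact: (linear_fun0 (L_linear i (- m))).
Qed.

(** An arbitrary mode is commuted past the lowering modes until it meets a primary vector, which it
    lowers, scales or kills. *)
Lemma descendant_mode z v i n : descendant z v -> descendant (z - n) (L i n v).
Proof.
move=> D; elim: D i n => {z v}.
- by move=> z i n; rewrite (linear_fun0 (L_linear i n)); apply: desc0.
- by move=> z a u v _ IHu _ IHv i n; rewrite L_linear; apply: desc_comb.
- move=> z v Bv i n; have [n0|n0|->] := ltgtP n 0.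
  + have := @desc_step i z (- n) v _ (desc_base Bv); rewrite opprK; apply; lia.
  + by rewrite (B_primary i Bv).2 //; apply: desc0.
  + have [[h ->] _] := B_primary i Bv; rewrite subr0.
    by apply: (subspaceZ _ (descendant_subspace _)); apply: desc_base.
- move=> j z m v m0 Dv IH i n.
  have [a [b ->]] := L_rel i j n (- m) v.
  apply: (subspaceD (descendant_subspace _)).
    apply: (subspaceD (descendant_subspace _)).
      have -> : z + m - n = z - n + m by lia.
      by apply: desc_step.
    apply: (subspaceZ _ (descendant_subspace _)).
    by have -> : z + m - n = z - (n - m) by lia; apply: IH.
  case: eqP => [nm|_]; last by rewrite scale0r; apply: desc0.
  apply: (subspaceZ _ (descendant_subspace _)).
  by have -> : z + m - n = z by lia.
Qed.

Lemma descendant_eigen (T : V -> V) (h : K) : linear T ->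
  (forall i n v, T (L i n v) = L i n (T v) - n%:~R *: L i n v) ->
  (forall z v, B z v -> T v = (h + z%:~R) *: v) ->
  forall z v, descendant z v -> T v = (h + z%:~R) *: v.
Proof.
move=> T_lin TL TB z v; elim=> {z v}.
- by move=> z; rewrite scaler0 (linear_fun0 T_lin).
- move=> z a u v _ IHu _ IHv; rewrite T_lin IHu IHv scalerDr !scalerA.
  by rewrite [a * _]mulrC.
- exact: TB.
- move=> i z m v m0 _ IH; rewrite TL IH (linear_funZ _ _ (L_linear i (- m))).
  by rewrite -scalerBl; congr (_ *: _); rewrite mulrNz opprK -addrA -rmorphD.
Qed.

Lemma descendant_span (Q : set V) :
  (forall P : set V, subspace P -> (forall i n v, P v -> P (L i n v)) ->
     (forall z v, B z v -> P v) -> forall v, Q v -> P v) ->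
  forall v, Q v -> lspan (fun w => exists z, descendant z w) v.
Proof.
apply; first exact: lspan_subspace.
  move=> i n v Sv; apply: (Sv [set w | lspan _ (L i n w)]).
    exact: (subspace_preim (L_linear i n) (lspan_subspace _)).
  move=> w [z Dz]; apply: sub_lspan; exists (z - n); exact: descendant_mode.
by move=> z v Bv; apply: sub_lspan; exists z; apply: desc_base.
Qed.

(** A substitute for ordered bases: that the lists [S z] span is checked on the primary vectors and
    on one lowering mode applied to one listed vector, which is a finite verification up to degree
    [top]. *)
Lemma descendant_fspan (S : int -> seq V) (top : int) :
  (forall z x, B z x -> z <= top -> fspan (S z) x) ->
  (forall i z m x, 0 < m -> z + m <= top -> x \in S z ->
     fspan (S (z + m)) (L i (- m) x)) ->
  forall z x, descendant z x -> z <= top -> fspan (S z) x.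
Proof.
move=> SB SL z x; elim=> {z x} [z|z a u v _ IHu _ IHv|z v|i z m v m0 _ IH] zt.
- by case: (fspan_subspace (S z)).
- apply: (subspace_comb a (fspan_subspace _)); [exact: IHu|exact: IHv].
- by move/SB; apply.
- have /IH : z <= top by lia.
  apply: (@fspan_min _ _ _ [set y | fspan _ (L i (- m) y)]).
    exact: (subspace_preim (L_linear i (- m)) (fspan_subspace _)).
  by move=> y yS; apply: SL.
Qed.

End Descendants.

Section ConformalVectors.
Variables (R : realType) (V : voa R).

Lemma mode_linear (a : V) n : linear (fun x => a _{n} x).
Proof. by move=> k x y; rewrite linearPr. Qed.

Lemma mode_linearl (b : V) n : linear (fun x => x _{n} b).
Proof. by move=> k x y; rewrite linearPl. Qed.

Lemma mode_omega0 (a b : V) n :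
  (omega V _{0} a) _{n} b = (- n)%:~R *: a _{n - 1} b.
Proof. exact: voa_derivative. Qed.

(** In the commutator formula, [x _{0} x] acts as a derivative, and [x _{3} x] contributes the
    binomial coefficient of m + 1 over 3 times c / 2, that is (m^3 - m) c / 12. *)
Lemma virasoro_of_products (c : R[i]) (x : V) :
  x _{0} x = omega V _{0} x -> x _{1} x = 2 *: x -> x _{2} x = 0 ->
  x _{3} x = (c / 2) *: vac V ->
  (forall n : nat, (4 <= n)%N -> x _{n%:Z} x = 0) ->
  virasoro_rel c (fun n v => x _{n + 1} v).
Proof.
move=> x0 x1 x2 x3 x4 m n v.
rewrite (mode_comm _ _ _ x4) !big_ord_recl big_ord0 /= !/bump /= !add1n.
rewrite x0 x1 x2 x3 mode_omega0 !linearZl_LR linear0l scaler0 add0r !addr0.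
rewrite zbin0 scale1r zbin1 /= voa_vac.
have -> : m + 1 + (n + 1) - 1 = m + n + 1 :> int by lia.
have -> : (m + 1 + (n + 1) - 3%:Z == -1) = (m + n == 0) by lia.
rewrite addrA !scalerA -scalerDl; congr (_ *: _ + _).
  by ring.
case: ifP => _; last by rewrite !scaler0.
congr (_ *: _).
rewrite /zbin !big_ord_recl big_ord0 /= /bump /=.
have -> : 3`!%:R = 6 :> R[i] by [].
by field.
Qed.

Lemma mode_comm0 (a b x : V) k :
  a _{0} (b _{k} x) = b _{k} (a _{0} x) + (a _{0} b) _{k} x.
Proof.
have := mode_comm_nat 0 a b x k; rewrite big_ord1 bin0 scale1r.
have -> : 0%:Z + k - 0%:Z = k by lia.
by move=> <-; rewrite addrC subrK.
Qed.

Lemma mode_comm1 (a b x : V) k :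
  a _{1} (b _{k} x) =
  b _{k} (a _{1} x) + ((a _{0} b) _{k + 1} x + (a _{1} b) _{k} x).
Proof.
have := mode_comm_nat 1 a b x k; rewrite !big_ord_recl big_ord0 /= !addr0 !scale1r.
have -> : 1%:Z + k - (bump 0 0)%:Z = k by rewrite /bump; lia.
have -> : 1%:Z + k = k + 1 by lia.
by move=> <-; rewrite addrC subrK.
Qed.

Lemma mode_comm2 (a b x : V) k :
  a _{2} (b _{k} x) = b _{k} (a _{2} x)
  + ((a _{0} b) _{k + 2} x + 2 *: (a _{1} b) _{k + 1} x + (a _{2} b) _{k} x).
Proof.
have := mode_comm_nat 2 a b x k; rewrite !big_ord_recl big_ord0 /= !addr0 !scale1r.
have -> : 2%:Z + k - (bump 0 0)%:Z = k + 1 by rewrite /bump; lia.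
have -> : 2%:Z + k - (bump 0 (bump 0 0))%:Z = k by rewrite /bump /=; lia.
have -> : 2%:Z + k = k + 2 by lia.
by rewrite addrA; move=> <-; rewrite addrC subrK.
Qed.

Lemma mode_comm3 (a b x : V) k :
  a _{3} (b _{k} x) = b _{k} (a _{3} x)
  + ((a _{0} b) _{k + 3} x + 3 *: (a _{1} b) _{k + 2} x
     + 3 *: (a _{2} b) _{k + 1} x + (a _{3} b) _{k} x).
Proof.
have := mode_comm_nat 3 a b x k; rewrite !big_ord_recl big_ord0 /= !addr0 !scale1r.
have -> : 3%:Z + k - (bump 0 0)%:Z = k + 2 by rewrite /bump; lia.
have -> : 3%:Z + k - (bump 0 (bump 0 0))%:Z = k + 1 by rewrite /bump /=; lia.
have -> : 3%:Z + k - (bump 0 (bump 0 (bump 0 0)))%:Z = k by rewrite /bump /=; lia.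
have -> : 3%:Z + k = k + 3 by lia.
have -> : 'C(3, bump 0 0) = 3%N by [].
have -> : 'C(3, bump 0 (bump 0 0)) = 3%N by [].
by rewrite !addrA => /(canRL (subrK _)) ->; rewrite [LHS]addrC !addrA.
Qed.

Lemma mode_omega1 (a x : V) k :
  omega V _{1} (a _{k} x) =
  a _{k} (omega V _{1} x) + (omega V _{1} a) _{k} x - (k + 1)%:~R *: a _{k} x.
Proof.
rewrite mode_comm1 mode_omega0 addrK -addrA; congr (_ + _).
by rewrite addrC rmorphN scaleNr.
Qed.

Lemma mode_weight (a b : V) n (p q : int) : weight p a -> weight q b ->
  weight (p + q - n - 1) (a _{n} b).
Proof.
rewrite /weight /virL /= add0r => wa wb.
rewrite mode_omega1 wa wb linearZr_LR linearZl_LR /=.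
by rewrite -scalerDl -scalerBl; congr (_ *: _); ring.
Qed.

Lemma weight_subspace (p : int) : subspace (@weight R V p).
Proof.
split; first by rewrite /weight /virL /= linear0r scaler0.
move=> a u v; rewrite /weight /virL /= linearPr => -> ->.
by rewrite scalerDr !scalerA [a * _]mulrC.
Qed.

End ConformalVectors.

(** * Z_3-graded extensions *)

Section Frame.
Variable R : realType.

Definition charge (i : bool) : R[i] := if i then 6 / 7 else 4 / 5.
Definition top_weight (i : bool) : R[i] := if i then 4 / 3 else 2 / 3.

(* What the proof uses of the extension U = U^0 + U^1 + U^2: [conf] gives the
   two Virasoro vectors, [base0 z x] the primary vectors x of weight z
   generating U^0 (the one of weight 0 is [ground]), [top j] the highest weight
   vector of U^j for j != 0. *)
Record frame (U : voa R) := Frame {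
  conf : bool -> U;
  piece : 'Z_3 -> set U;
  base0 : int -> U -> Prop;
  ground : U;
  top : 'Z_3 -> U;
  frame_simple : voa_simple U;
  frame_omega : omega U = conf false + conf true;
  conf_0 : forall i, conf i _{0} conf i = omega U _{0} conf i;
  conf_1 : forall i, conf i _{1} conf i = 2 *: conf i;
  conf_2 : forall i, conf i _{2} conf i = 0;
  conf_3 : forall i, conf i _{3} conf i = (charge i / 2) *: vac U;
  conf_4 : forall i (n : nat), (4 <= n)%N -> conf i _{n%:Z} conf i = 0;
  conf_neq : forall i (n : nat), conf i _{n%:Z} conf (~~ i) = 0;
  piece_direct : internal_direct_sum piece;
  piece_mode : forall (i j : 'Z_3) (n : int) (u v : U),
    piece i u -> piece j v -> piece (i + j) (u _{n} v);
  piece_vac : piece 0 (vac U);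
  piece_conf : forall i, piece 0 (conf i);
  base0_piece : forall z x, base0 z x -> piece 0 x;
  base0_weight : forall z x, base0 z x -> weight z x;
  base0_primary : forall z x i, base0 z x ->
    (exists a : R[i], conf i _{1} x = a *: x) /\
    forall n : int, 1 < n -> conf i _{n} x = 0;
  base0_level : forall z x, base0 z x -> (z = 0 /\ x = ground) \/ 3 <= z;
  base0_gen : forall P : set U, subspace P ->
    (forall i n x, P x -> P (conf i _{n} x)) ->
    (forall z x, base0 z x -> P x) -> piece 0 `<=` P;
  top_neq0 : forall j, j != 0 -> top j != 0;
  top_piece : forall j, j != 0 -> piece j (top j);
  top_1 : forall i j, j != 0 -> conf i _{1} top j = top_weight i *: top j;
  top_2 : forall i j, j != 0 -> forall n : int, 1 < n -> conf i _{n} top j = 0;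
  top_gen : forall j, j != 0 -> forall P : set U, subspace P ->
    (forall i n x, P x -> P (conf i _{n} x)) -> P (top j) -> piece j `<=` P
}.

Variables (U : voa R) (F : frame U).
Local Notation o := (conf F).
Local Notation G := (piece F).
Local Notation w := (top F).

(** The usual index: this is L^i(n). Thus [o i _{-1}], [o i _{0}], [o i _{1}], [o i _{2}],
    [o i _{3}] are L^i(-2), L^i(-1), L^i(0), L^i(1), L^i(2). *)
Definition cmode (i : bool) (n : int) (x : U) : U := o i _{n + 1} x.

Definition base (j : 'Z_3) (z : int) (x : U) : Prop :=
  if j == 0 then base0 F z x else z = 2 /\ x = w j.

Definition homog (j : 'Z_3) (z : int) : set U := [set x | G j x /\ weight z x].

Lemma conf_vir i : virasoro_rel (charge i) (cmode i).
Proof.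
apply: virasoro_of_products; [exact: conf_0|exact: conf_1|exact: conf_2| |].
  exact: conf_3.
exact: conf_4.
Qed.

Lemma cmode_linear i n : linear (cmode i n).
Proof. exact: mode_linear. Qed.

Lemma conf_comm i m n x : o i _{m} (o (~~ i) _{n} x) = o (~~ i) _{n} (o i _{m} x).
Proof.
apply/eqP; rewrite -subr_eq0 (@mode_comm _ _ 0) ?big_ord0 // => k _.
exact: conf_neq.
Qed.

Lemma cmode_rel i j m n v : exists a b : R[i],
  cmode i m (cmode j n v) = cmode j n (cmode i m v) + a *: cmode i (m + n) v
                    + (if m + n == 0 then b else 0) *: v.
Proof.
have [->|ij] := eqVneq i j; last first.
  exists 0, 0; rewrite if_same !scale0r !addr0.
  have -> : j = ~~ i by case: i ij; case: j.
  exact: conf_comm.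
exists (m - n)%:~R, ((m ^+ 3 - m)%:~R / 12 * charge j).
have /(canRL (subrK _)) -> := conf_vir j m n v.
by rewrite [LHS]addrC addrA; case: ifP; rewrite ?scale0r.
Qed.

Lemma conf_1_weight i : weight 2 (o i).
Proof.
rewrite /weight /virL /= add0r (frame_omega F) linearDl.
case: i; rewrite conf_1.
  by rewrite (conf_neq F false 1) add0r.
by rewrite (conf_neq F true 1) addr0.
Qed.

Lemma top_weight_2 j : j != 0 -> weight 2 (w j).
Proof.
move=> j0; rewrite /weight /virL /= add0r (frame_omega F) linearDl !top_1 //.
by rewrite -scalerDl; congr (_ *: _); rewrite /top_weight; field.
Qed.

Lemma base_ge0 j z x : base j z x -> 0 <= z.
Proof.
rewrite /base; case: ifP => _; last by case=> ->.
by move=> /base0_level [[->]|] //; lia.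
Qed.

Lemma base_primary j z v i : base j z v ->
  (exists h : R[i], cmode i 0 v = h *: v) /\ forall n, 0 < n -> cmode i n v = 0.
Proof.
rewrite /base /cmode add0r; case: ifP => [_|/negbT j0].
  move=> /(base0_primary i) [h1 h2]; split=> // n n0; apply: h2; lia.
move=> [_ ->]; split; first by exists (top_weight i); rewrite top_1.
by move=> n n0; rewrite top_2 //; lia.
Qed.

Lemma base_homog j z v : base j z v -> homog j z v.
Proof.
rewrite /base; case: eqP => [->|/eqP j0].
  by move=> bv; split; [apply: base0_piece bv|apply: base0_weight bv].
by move=> [-> ->]; split; [apply: top_piece|apply: top_weight_2].
Qed.

Lemma piece_subspace j : subspace (G j).
Proof. by case: (piece_direct F). Qed.

Lemma homog_subspace j z : subspace (homog j z).
Proof.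
split; first by split; [case: (piece_subspace j)|case: (weight_subspace U z)].
move=> a u v [Gu wu] [Gv wv]; split.
  exact: (subspace_comb a (piece_subspace j)).
exact: (subspace_comb a (weight_subspace U z)).
Qed.

Lemma homog_mode j k (y z n : int) a b : homog j y a -> homog k z b ->
  homog (j + k) (y + z - n - 1) (a _{n} b).
Proof. by move=> [Ga wa] [Gb wb]; split; [apply: piece_mode|apply: mode_weight]. Qed.

Lemma homog_conf i : homog 0 2 (o i).
Proof. by split; [apply: piece_conf|apply: conf_1_weight]. Qed.

Lemma descendant_homog j z x : descendant cmode (base j) z x -> homog j z x.
Proof.
elim=> {z x} [z|z a u v _ hu _ hv|z v|i z m v m0 _ hv].
- by case: (homog_subspace j z).
- exact: (subspace_comb a (homog_subspace j z)).
- exact: base_homog.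
- have := homog_mode (- m + 1) (homog_conf i) hv; rewrite add0r.
  by have -> : 2 + z - (- m + 1) - 1 = z + m by lia.
Qed.

Lemma piece_span j x : G j x ->
  lspan (fun w => exists z, descendant cmode (base j) z w) x.
Proof.
apply: (descendant_span cmode_linear cmode_rel (@base_primary j)).
move=> P sP cP bP; rewrite /base in bP.
have cP' i n v : P v -> P (o i _{n} v).
  by move=> /(cP i (n - 1)); rewrite /cmode subrK.
move: bP; case: (eqVneq j 0) => [-> bP|j0 bP].
  exact: base0_gen.
by apply: top_gen => //; apply: (bP 2).
Qed.

(** Descendants span the piece and are weight vectors for their degree, so [graded_eigen] applies to
    the weight operator. *)
Lemma homog_descendant j z x : homog j z x -> descendant cmode (base j) z x.
Proof.
case=> Gx wx.
apply: (@graded_eigen _ _ (fun v => omega U _{1} v) (mode_linear _ _) _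
  (fun z => z%:~R)).
- exact: descendant_subspace.
- move=> y v; apply: (descendant_neg cmode_linear); exact: base_ge0.
- by move=> y v /descendant_homog [_]; rewrite /weight /virL /= add0r.
- exact: intr_inj.
- exact: piece_span.
- by move: wx; rewrite /weight /virL /= add0r.
Qed.

End Frame.

(** * Spanning lists for the homogeneous spaces of low weight *)

Section LowWeights.
Variables (R : realType) (U : voa R) (F : frame U).
Local Notation o := (conf F).
Local Notation G := (piece F).
Local Notation w := (top F).
Local Notation homog := (homog F).

Lemma vac_neq0 : vac U != 0.
Proof.
case: (frame_simple F) => -[v v0] _; apply: contra_neq v0 => e.
by have := voa_vac (-1) v; rewrite e linear0l eqxx => <-.
Qed.

Lemma vac_weight : weight 0 (vac U).
Proof. by rewrite /weight /virL /= (voa_creation _).2 // scale0r. Qed.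

Definition low0 (z : int) : seq U :=
  match z with Posz 0 => [:: vac U] | Posz 2 => [:: o false; o true] | _ => [::] end.

(** The primary vector of weight 0 is known only as a generator. In weight 0 its descendants are its
    own multiples, and the nonzero vacuum is one of them. *)
Lemma ground_vac : exists a, ground F = a *: vac U.
Proof.
pose S (z : int) := if z == 0 then [:: ground F] else [::].
have : fspan (S 0) (vac U).
  apply: (@descendant_fspan _ _ _ _ (base F 0) (cmode_linear F) S 0 _ _ 0) => //.
  - move=> z x /base0_level [[-> ->] _|]; last by lia.
    by rewrite /S eqxx; apply: mem_fspan; rewrite inE.
  - by move=> i z m x m0 zm; rewrite /S; case: eqP => //; lia.
  - by apply: homog_descendant; split; [apply: piece_vac|apply: vac_weight].
case=> c; rewrite /S /= big_ord1 /= => e; exists (c 0%N)^-1.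
have c0 : c 0%N != 0.
  by apply: contra_neq vac_neq0 => c0; rewrite e c0 scale0r.
by rewrite e scalerA mulVf // scale1r.
Qed.

(** The other primary vectors of U^0 have weight at least 3, so up to weight 2 only descendants of
    the vacuum occur. *)
Lemma homog0_low z x : homog 0 z x -> z <= 2 -> fspan (low0 z) x.
Proof.
move=> /homog_descendant; apply: (descendant_fspan (cmode_linear F)) => {z x}.
  move=> z x /base0_level [[-> ->] _|]; last by lia.
  have [a ->] := ground_vac; apply: (subspaceZ _ (fspan_subspace _)).
  by apply: mem_fspan; rewrite inE.
(* Two cases survive: L^i(-1) kills the vacuum, whence the empty list in weight 1, and L^i(-2) sends
   it to [o i]. *)
move=> i [[|[|[|z]]]|z] [[|[|m]]|m] x //=; try lia; rewrite !inE => m0 zm /eqP ->.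
- rewrite /cmode addNr (voa_creation _).2 //; apply: (fspan_subspace _).1.
- case: m m0 zm => [|m] m0 zm; last by lia.
  rewrite /cmode (_ : - 2%:Z + 1 = -1) // (voa_creation _).1.
  by apply: mem_fspan; rewrite !inE; case: (i); rewrite eqxx ?orbT.
Qed.

Lemma homog0_neg z x : z < 0 -> homog 0 z x -> x = 0.
Proof.
move=> z0 h; have := homog0_low h; case: z z0 {h} => // z _ /(_ isT) [c ->].
by rewrite big_ord0.
Qed.

Lemma homog00 x : homog 0 0 x -> exists a, x = a *: vac U.
Proof.
by move=> /homog0_low /(_ isT) [c ->]; exists (c 0%N); rewrite big_ord1.
Qed.

Lemma homog01 x : homog 0 1 x -> x = 0.
Proof. by move=> /homog0_low /(_ isT) [c ->]; rewrite big_ord0. Qed.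

Lemma homog02 x : homog 0 2 x -> exists a b, x = a *: o false + b *: o true.
Proof.
move=> /homog0_low /(_ isT) [c ->]; exists (c 0%N), (c 1%N).
by rewrite !big_ord_recl big_ord0 addr0.
Qed.

Definition low_top (j : 'Z_3) (z : int) : seq U :=
  match z with
  | Posz 2 => [:: w j]
  | Posz 3 => [:: o false _{0} w j; o true _{0} w j]
  | Posz 4 => [:: o false _{0} (o false _{0} w j); o false _{-1} w j;
       o false _{0} (o true _{0} w j); o true _{0} (o true _{0} w j);
       o true _{-1} w j]
  | _ => [::] end.

Lemma homog_top_low j z x : j != 0 -> homog j z x -> z <= 4 -> fspan (low_top j z) x.
Proof.
move=> j0 /homog_descendant; apply: (descendant_fspan (cmode_linear F)) => {z x}.
  move=> z x; rewrite /base (negbTE j0) => -[-> ->] _.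
  by apply: mem_fspan; rewrite inE.
move=> i [[|[|[|[|z]]]]|z] [[|[|[|m]]]|m] x //= m0 zm; try lia; rewrite !inE.
- move/eqP ->; rewrite /cmode addNr; apply: mem_fspan.
  by rewrite !inE; case: (i); rewrite eqxx ?orbT.
- move/eqP ->; rewrite /cmode (_ : - 2%:Z + 1 = -1) //; apply: mem_fspan.
  by rewrite !inE; case: (i); rewrite eqxx ?orbT.
- rewrite /cmode addNr; have e := conf_comm F false 0 0 (w j).
  by case/orP=> /eqP ->; apply: mem_fspan; rewrite !inE; case: (i);
    rewrite -?e /= eqxx ?orbT.
Qed.

Lemma homog_top_lt2 j z x : j != 0 -> z < 2 -> homog j z x -> x = 0.
Proof.
move=> j0 z2 /(homog_top_low j0).
by case: z z2 => [[|[|z]]|z] // z2 /(_ isT) [c ->]; rewrite big_ord0.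
Qed.

Lemma homog_top2 j x : j != 0 -> homog j 2 x -> exists a, x = a *: w j.
Proof.
move=> j0 /(homog_top_low j0) /(_ isT) [c ->].
by exists (c 0%N); rewrite big_ord1.
Qed.

Lemma homog_top3 j x : j != 0 -> homog j 3 x ->
  exists a : bool -> R[i], x = a false *: (o false _{0} w j) + a true *: (o true _{0} w j).
Proof.
move=> j0 /(homog_top_low j0) /(_ isT) [c ->].
by exists (fun i => if i then c 1%N else c 0%N); rewrite !big_ord_recl big_ord0 addr0.
Qed.

Lemma homog_top4 j x : j != 0 -> homog j 4 x ->
  exists (a b : bool -> R[i]) c,
    x = a false *: (o false _{0} (o false _{0} w j)) + b false *: (o false _{-1} w j)
      + c *: (o false _{0} (o true _{0} w j))
      + (a true *: (o true _{0} (o true _{0} w j)) + b true *: (o true _{-1} w j)).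
Proof.
move=> j0 /(homog_top_low j0) /(_ isT) [c ->].
exists (fun i => if i then c 3 else c 0%N), (fun i => if i then c 4 else c 1%N), (c 2).
by rewrite !big_ord_recl big_ord0 addr0 /= !addrA.
Qed.

Lemma homog_neg j z x : z < 0 -> homog j z x -> x = 0.
Proof.
case: (eqVneq j 0) => [->|j0] z0; first exact: homog0_neg.
by apply: homog_top_lt2 => //; lia.
Qed.

Lemma homog1 j x : homog j 1 x -> x = 0.
Proof.
case: (eqVneq j 0) => [->|j0]; first exact: homog01.
exact: homog_top_lt2.
Qed.

(* The weight operator preserves the pieces, so the components of an
   eigenvector are eigenvectors. *)
Lemma weight_homog z (x : U) : weight z x ->
  exists y : 'Z_3 -> U, (forall j, homog j z (y j)) /\ x = \sum_j y j.
Proof.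
case: (piece_direct F) => _ dec uniq wx.
have [y [Gy xE]] := dec x; exists y; split=> // j; split=> //.
have Go (k : 'Z_3) v : G k v -> G k (omega U _{1} v).
  move=> Gv; rewrite -[k]add0r; apply: piece_mode => //.
  rewrite (frame_omega F).
  by apply: (subspaceD (piece_subspace F 0)); apply: piece_conf.
rewrite /weight /virL /= add0r; apply/eqP; rewrite -subr_eq0; apply/eqP.
apply: (uniq (fun j => omega U _{1} y j - z%:~R *: y j)) => [k|].
  apply: (subspaceB (piece_subspace F k)); first exact: Go.
  exact: (subspaceZ _ (piece_subspace F k)).
rewrite sumrB -scaler_sumr -linear_sumr -xE.
by move: wx; rewrite /weight /virL /= add0r => ->; rewrite subrr.
Qed.

Lemma weight_neg z (x : U) : z < 0 -> weight z x -> x = 0.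
Proof.
move=> z0 /weight_homog [y [hy ->]]; apply: big1 => j _.
exact: homog_neg (hy j).
Qed.

Lemma weight1 (x : U) : weight 1 x -> x = 0.
Proof. by move=> /weight_homog [y [hy ->]]; apply: big1 => j _; apply: homog1 (hy j). Qed.

Lemma weight0 (x : U) : weight 0 x -> exists a, x = a *: vac U.
Proof.
move=> /weight_homog [y [hy ->]].
have [a ya] := homog00 (hy 0); exists a; rewrite (bigD1 0) //= ya big1 ?addr0 // => j j0.
exact: homog_top_lt2 (hy j).
Qed.

End LowWeights.

(** * The top vectors of opposite pieces pair nontrivially *)

Section Pairing.
Variables (R : realType) (U : voa R) (F : frame U).
Local Notation o := (conf F).
Local Notation G := (piece F).
Local Notation w := (top F).
Local Notation homog := (homog F).

Lemma top_homog j : j != 0 -> homog j 2 (w j).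
Proof. by move=> j0; split; [apply: top_piece|apply: top_weight_2]. Qed.

Lemma homog_conf_mode i j n z x : homog j z x -> homog j (z + 1 - n) (o i _{n} x).
Proof.
move=> hx; have := homog_mode n (homog_conf F i) hx; rewrite add0r.
by have -> : 2 + z - n - 1 = z + 1 - n by lia.
Qed.

(* If the top vectors pair to zero, then no product of an element of the
   piece of -j with the top vector of the piece of j has a vacuum component. *)
Lemma pairing_vanish j : j != 0 -> w (- j) _{3} w j = 0 ->
  forall (n : nat) z a, homog (- j) z a -> z <= n%:Z -> a _{z + 1} w j = 0.
Proof.
move=> j0 wj0; have Nj0 : - j != 0 by rewrite oppr_eq0.
set u := w j.
have hu : homog j 2 u by apply: top_homog.
have hau z n a : homog (- j) z a -> homog 0 (z + 1 - n) (a _{n} u).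
  move=> ha; have := homog_mode n ha hu; rewrite addNr.
  by have -> : z + 2 - n - 1 = z + 1 - n by lia.
have hau0 z n a : homog (- j) z a -> z + 1 < n -> a _{n} u = 0.
  by move=> /hau ha zn; apply: homog0_neg (ha n); lia.
elim=> [|n IH] z a ha zn.
  by rewrite (homog_top_lt2 Nj0 _ ha) ?linear0l //; lia.
move: (homog_descendant ha) zn; elim=> {z a ha}.
- by move=> z _; rewrite linear0l.
- by move=> z c a b _ IHa _ IHb zn; rewrite linearPl IHa // IHb // scaler0 addr0.
- by move=> z a; rewrite /base (negbTE Nj0) => -[-> ->] _.
move=> i z m b m0 /descendant_homog hb _ zn; rewrite /cmode.
(* The case of L^i(-1) is separate, since the other case applies the induction hypothesis to L^i(-1)
   b, of weight z + 1 < z + m. Here L^i(1) is commuted with [b _{z}] on [u]: the vector [b _{z} u]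
   is zero, having weight 1 in U^0. *)
have [m1|m1] := eqVneq m 1.
  rewrite {}m1 in zn *; rewrite addNr.
  have := mode_comm2 (o i) b u z.
  rewrite (@homog01 _ _ F (b _{z} u)); last first.
    by have := hau _ z _ hb; rewrite (_ : z + 1 - z = 1) //; lia.
  rewrite top_2 // !linear0r add0r.
  rewrite (IH z) ?scaler0 ?addr0; last by lia.
    have := IH (z - 1) (o i _{2} b); rewrite subrK => ->; first last.
    - by lia.
    - by have := homog_conf_mode i 2 hb; rewrite (_ : z + 1 - 2 = z - 1) //; lia.
    by have -> : z + 1 + 1 = z + 2 by [rewrite -addrA]; rewrite addr0 => <-.
  by have := homog_conf_mode i 1 hb; rewrite addrK.
(* For m >= 2 associativity leaves modes of [b] on [u], zero because their weight is negative, and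
   modes of [b] on L^i(-1) u and L^i(0) u, which reduce to smaller weights. *)
rewrite (@mode_assoc _ _ 2); first last.
- by case=> [|[|k]] // _; rewrite top_2.
- by move=> k _; apply: (hau0 z) => //; lia.
rewrite !big_ord_recl big_ord0 addr0 /= !addr0.
have -> : b _{z + m + 1} u = 0 by apply: (hau0 z) => //; lia.
have -> : b _{z + m + 1 + (bump 0 0)%:Z} u = 0.
  by apply: (hau0 z) => //; rewrite /bump; lia.
have -> : - m + 1 + (z + m + 1) - (bump 0 0)%:Z = z + 1 by rewrite /bump; lia.
have -> : - m + 1 + (z + m + 1) = z + 2 by lia.
have -> : o i _{(bump 0 0)%:Z} u = top_weight R i *: u by apply: top_1.
rewrite linearZr_LR (IH z b hb); last by lia.
have -> : b _{z + 2} (o i _{0%:Z} u) = 0.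
  have := mode_comm0 (o i) b u (z + 2); rewrite (hau0 z) //; last by lia.
  have := IH (z + 1) (o i _{0} b); rewrite -addrA => ->; first last.
  - by lia.
  - by have := homog_conf_mode i 0 hb; rewrite subr0.
  by rewrite linear0r addr0.
by rewrite !linear0r !scaler0 subrr !scaler0 addr0.
Qed.

Lemma piece_ind j (P : set U) : subspace P ->
  (forall z x, homog j z x -> P x) -> G j `<=` P.
Proof.
move=> sP hP x /piece_span; apply: lspan_min => // y [z /descendant_homog].
exact: hP.
Qed.

Lemma voa_ind (P : set U) : subspace P ->
  (forall j z x, homog j z x -> P x) -> forall x, P x.
Proof.
move=> sP hP x; case: (piece_direct F) => _ /(_ x) [y [Gy ->]] _.
by apply: subspace_sum => // j _; apply: (piece_ind sP (hP j)).
Qed.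

Lemma submodule_full (P : set U) x : subspace P -> P x -> x != 0 ->
  (forall a n y, P y -> P (a _{n} y)) -> forall y, P y.
Proof.
move=> sP Px x0 Pm y; case: (frame_simple F) => _ /(_ P sP).
have Pm' (i : U * int) v : P v -> P (i.1 _{i.2} v) by apply: Pm.
case/(_ (fun i => @Pm' i)) => PE; last by rewrite PE.
by move: Px x0; rewrite PE => /= ->; rewrite eqxx.
Qed.

(** The products [b _{n} w j] span a nonzero ideal, hence all of U by simplicity. If the pairing
    vanished, all of them would lie in the span of positive weights, which does not contain the
    vacuum. *)
Lemma top_pairing_neq0 j : j != 0 -> w (- j) _{3} w j != 0.
Proof.
move=> j0; have Nj0 : - j != 0 by rewrite oppr_eq0.
apply/negP => /eqP /(pairing_vanish j0) van.
pose pos : set U := lspan (fun x => exists z : int, 0 < z /\ weight z x).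
have pos_s : subspace pos by apply: lspan_subspace.
have product_pos b n : pos (b _{n} w j).
  apply: (voa_ind (P := [set b | pos (b _{n} w j)])).
    exact: (subspace_preim (mode_linearl _ _) pos_s).
  move=> k z {}b hb /=; have hbn := homog_mode n hb (top_homog j0).
  have [nz|nz|nz] := ltgtP (z + 2 - n - 1) 0.
  - by rewrite (homog_neg nz hbn); case: pos_s.
  - by apply: sub_lspan; exists (z + 2 - n - 1); split=> //; case: hbn.
  have [kj|kj] := eqVneq (k + j) 0; last first.
    by rewrite (homog_top_lt2 kj _ hbn) ?nz //; case: pos_s.
  have kE : k = - j by apply/eqP; rewrite -addr_eq0 kj.
  have -> : n = z + 1 by lia.
  rewrite kE in hb; rewrite (van (absz z) z b hb); last by lia.
  by case: pos_s.
have : pos (vac U).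
  pose S : set U := lspan (fun x => exists b n, x = b _{n} w j).
  have : S (vac U).
    apply: (@submodule_full _ (w j)); [exact: lspan_subspace| |exact: top_neq0|].
      by apply: sub_lspan; exists (vac U), (-1); rewrite voa_vac eqxx.
    move=> a n y; apply: (lspan_min (P := [set y | S (a _{n} y)])).
      exact: (subspace_preim (mode_linear _ _) (lspan_subspace _)).
    by move=> _ [b [m ->]]; apply: mode_product_span.
  by apply: lspan_min => // _ [b [n ->]].
move=> /(positive_span_eigen (mode_linear (omega U) 1)
  (D := @weight R U) (e := fun z : int => z%:~R)) vac0.
apply/negP: (vac_neq0 F); rewrite negbK; apply/eqP/vac0.
- exact: weight_subspace.
- by move=> z x; rewrite /weight /virL /= add0r.
- exact: intr_inj.
- by rewrite (voa_creation _).2 // scale0r.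
Qed.

End Pairing.

(** * The weight two algebra *)

Lemma Z3_double (j : 'Z_3) : j + j = - j.
Proof. by case: j => [[|[|[|//]]] ij]; apply/val_inj. Qed.

Lemma scale_inj (K : fieldType) (V : lmodType K) (a b : K) (v : V) :
  v != 0 -> a *: v = b *: v -> a = b.
Proof.
move=> v0 /eqP; rewrite -subr_eq0 -scalerBl scaler_eq0 (negbTE v0) orbF subr_eq0.
by move/eqP.
Qed.

Section GriessAlgebra.
Variables (R : realType) (U : voa R) (F : frame U).
Local Notation o := (conf F).
Local Notation homog := (homog F).

Lemma griess_mode2 (x y : U) : weight 2 x -> weight 2 y -> x _{2} y = 0.
Proof. by move=> wx wy; apply: (weight1 F); apply: (mode_weight 2 wx wy). Qed.

Lemma griess_mode4 (x y : U) n : weight 2 x -> weight 2 y -> 3 < n -> x _{n} y = 0.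
Proof.
by move=> wx wy n3; apply: (weight_neg F) (mode_weight n wx wy); lia.
Qed.

Lemma griess_mode3 (x y : U) : weight 2 x -> weight 2 y ->
  exists a, x _{3} y = a *: vac U.
Proof. by move=> wx wy; apply: (weight0 F); apply: (mode_weight 3 wx wy). Qed.

(** The corrections to commutativity in the skew-symmetry formula vanish: [x _{2} y] lies in U_1 =
    0, and [x _{3} y] is a multiple of the vacuum, whose mode -3 is zero. *)
Lemma griess_sym1 (x y : U) : weight 2 x -> weight 2 y -> y _{1} x = x _{1} y.
Proof.
move=> wx wy; rewrite (@mode_skew _ _ 3 x); last first.
  by move=> k k3; apply: griess_mode4 => //; lia.
have [a e3] := griess_mode3 wx wy.
have e2 := griess_mode2 wx wy.
rewrite !big_ord_recl big_ord0 /= expr1z opprK scale1r expr0 scale1r !addr0.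
rewrite (_ : 1 + (bump 0 0)%:Z = 2) // (_ : 1 + (bump 0 (bump 0 0))%:Z = 3) //.
by rewrite e2 e3 linear0l scaler0 linearZl_LR voa_vac !scaler0 !addr0 (voa_creation _).1.
Qed.

Lemma griess_sym3 (x y : U) : weight 2 x -> weight 2 y -> y _{3} x = x _{3} y.
Proof.
move=> wx wy; rewrite (@mode_skew _ _ 1 x); last first.
  by move=> k k3; apply: griess_mode4 => //; lia.
rewrite big_ord1 expr0 scale1r !addr0 (voa_creation _).1.
by rewrite (_ : - (-1) ^ 3 = 1) ?scale1r // -exprnP; ring.
Qed.

(** Skew-symmetry of x with itself gives 2 x_(0) x = L(-1) (x_(1) x). So for conformality it
    suffices to control [x _{1} x] and [x _{3} x]. *)
Lemma griess_mode0 (x : U) : weight 2 x ->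
  x _{0} x = (1 / 2) *: (omega U _{0} (x _{1} x)).
Proof.
move=> wx; have [a e3] := griess_mode3 wx wx.
have e2 := griess_mode2 wx wx.
have : x _{0} x = - (-1) ^ 0 *: \sum_(j < 4)
    (-1) ^+ j *: (x _{0 + j%:Z} x) _{-1 - j%:Z} (vac U).
  by apply: mode_skew => k k4; apply: griess_mode4 => //; lia.
rewrite !big_ord_recl big_ord0 /= expr0z expr0 scale1r !addr0 !add0r.
rewrite (_ : (bump 0 (bump 0 0))%:Z = 2) // (_ : (bump 0 (bump 0 (bump 0 0)))%:Z = 3) //.
rewrite e2 e3 linear0l scaler0 linearZl_LR voa_vac !scaler0 !addr0 (voa_creation _).1.
rewrite (_ : -1 - (bump 0 0)%:Z = -2) // mode_translate scaleN1r.
rewrite expr1 scaleN1r opprB => /eqP; rewrite eq_sym subr_eq => /eqP ->.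
by rewrite scalerDr -scalerDl -[LHS]scale1r; congr (_ *: _); field.
Qed.

Lemma conf_10 i x : o i _{1} (o i _{0} x) = o i _{0} (o i _{1} x) + o i _{0} x.
Proof.
rewrite mode_comm1 conf_0 conf_1 mode_omega0 linearZl_LR /= -scalerDl add0r subrr.
by congr (_ + _); rewrite -[RHS]scale1r; congr (_ *: _); ring.
Qed.

Lemma conf_20 i x : o i _{2} (o i _{0} x) = o i _{0} (o i _{2} x) + 2 *: o i _{1} x.
Proof.
rewrite mode_comm2 conf_0 conf_1 conf_2 mode_omega0 linear0l addr0 linearZl_LR /=.
by rewrite scalerA -scalerDl; congr (_ + _ *: _); ring.
Qed.

Lemma conf_30 i x : o i _{3} (o i _{0} x) = o i _{0} (o i _{3} x) + 3 *: o i _{2} x.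
Proof.
rewrite mode_comm3 conf_0 conf_1 conf_2 conf_3 mode_omega0 linear0l !linearZl_LR /=.
rewrite voa_vac /= scaler0 scaler0 !addr0 scalerA -scalerDl.
by congr (_ + _ *: _); ring.
Qed.

Lemma conf_2N i x : o i _{2} (o i _{-1} x) = o i _{-1} (o i _{2} x) + 3 *: o i _{0} x.
Proof.
rewrite mode_comm2 conf_0 conf_1 conf_2 mode_omega0 linear0l addr0 linearZl_LR /=.
by rewrite scalerA -scalerDl; congr (_ + _ *: _); ring.
Qed.

Lemma conf_3N i x : o i _{3} (o i _{-1} x) =
  o i _{-1} (o i _{3} x) + (4 *: o i _{1} x + (charge R i / 2) *: x).
Proof.
rewrite mode_comm3 conf_0 conf_1 conf_2 conf_3 mode_omega0 linear0l !linearZl_LR /=.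
rewrite voa_vac /= scaler0 !addr0 scalerA -scalerDl.
by congr (_ + (_ *: _ + _)); ring.
Qed.

End GriessAlgebra.

(** * Raising modes on the first two levels over a top vector, and the products of that vector with
    itself *)

Section TopModes.
Variables (R : realType) (U : voa R) (F : frame U).
Local Notation o := (conf F).
Local Notation w := (top F).
Local Notation h := (top_weight R).

Variable j : 'Z_3.
Hypothesis j_neq0 : j != 0.

Lemma conf_10_top i k :
  o i _{1} (o k _{0} w j) = (h i + (i == k)%:R) *: o k _{0} w j.
Proof.
have [<-|ik] := eqVneq i k.
  by rewrite conf_10 top_1 // linearZr_LR -[X in _ + X]scale1r -scalerDl.
have -> : k = ~~ i by case: i ik; case: k.
by rewrite conf_comm top_1 // linearZr_LR addr0.
Qed.

Lemma conf_20_top i k : o i _{2} (o k _{0} w j) = (2 * h i * (i == k)%:R) *: w j.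
Proof.
have [<-|ik] := eqVneq i k.
  by rewrite conf_20 top_2 // top_1 // linear0r add0r scalerA mulr1.
have -> : k = ~~ i by case: i ik; case: k.
by rewrite conf_comm top_2 // linear0r mulr0 scale0r.
Qed.

Lemma conf_30_top i k : o i _{3} (o k _{0} w j) = 0.
Proof.
have [<-|ik] := eqVneq i k.
  by rewrite conf_30 !top_2 // linear0r scaler0 addr0.
have -> : k = ~~ i by case: i ik; case: k.
by rewrite conf_comm top_2 // linear0r.
Qed.

Lemma conf_2N_top i k : o i _{2} (o k _{-1} w j) = (3 * (i == k)%:R) *: o i _{0} w j.
Proof.
have [<-|ik] := eqVneq i k.
  by rewrite conf_2N top_2 // linear0r add0r mulr1.
have -> : k = ~~ i by case: i ik; case: k.
by rewrite conf_comm top_2 // linear0r mulr0 scale0r.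
Qed.

Lemma conf_3N_top i k :
  o i _{3} (o k _{-1} w j) = ((4 * h i + charge R i / 2) * (i == k)%:R) *: w j.
Proof.
have [<-|ik] := eqVneq i k.
  by rewrite conf_3N top_2 // top_1 // linear0r add0r scalerA -scalerDl mulr1.
have -> : k = ~~ i by case: i ik; case: k.
by rewrite conf_comm top_2 // linear0r mulr0 scale0r.
Qed.

Lemma conf_200_top i k l : o i _{2} (o k _{0} (o l _{0} w j)) =
  (2 * h i * (i == l)%:R) *: o k _{0} w j
  + (2 * (i == k)%:R * (h i + (i == l)%:R)) *: o l _{0} w j.
Proof.
have [<-|ik] := eqVneq i k.
  by rewrite conf_20 conf_20_top conf_10_top linearZr_LR scalerA mulr1.
have kE : k = ~~ i by case: i ik; case: k.
by rewrite {1}kE conf_comm -kE conf_20_top linearZr_LR mulr0 mul0r scale0r addr0.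
Qed.

Lemma conf_300_top i k l : o i _{3} (o k _{0} (o l _{0} w j)) =
  (6 * h i * (i == k)%:R * (i == l)%:R) *: w j.
Proof.
have [<-|ik] := eqVneq i k.
  rewrite conf_30 conf_30_top conf_20_top linear0r add0r scalerA.
  by congr (_ *: _); rewrite /=; ring.
have kE : k = ~~ i by case: i ik; case: k.
by rewrite kE conf_comm conf_30_top linear0r mulr0 mul0r scale0r.
Qed.

End TopModes.

Section SelfProduct.
Variables (R : realType) (U : voa R) (F : frame U).
Local Notation o := (conf F).
Local Notation w := (top F).
Local Notation homog := (homog F).
Local Notation h := (top_weight R).
Local Notation c := (charge R).

Variable j : 'Z_3.
Hypothesis j_neq0 : j != 0.
Let u := w j.
Let v := w (- j).

Let Nj_neq0 : - j != 0. Proof. by rewrite oppr_eq0. Qed.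
Let hu : homog j 2 u. Proof. exact: top_homog. Qed.
Let v_neq0 : v != 0. Proof. exact: top_neq0. Qed.

Let hprod y z n a b : homog j y a -> homog j z b -> homog (- j) (y + z - n - 1) (a _{n} b).
Proof. by move=> ha hb; rewrite -Z3_double; apply: homog_mode. Qed.

Lemma self_product : exists la, u _{1} u = la *: v.
Proof. exact: homog_top2 Nj_neq0 (hprod 1 hu hu). Qed.

Variable la : R[i].
Hypothesis uu1 : u _{1} u = la *: v.

Let o1u i : o i _{1} u = h i *: u. Proof. exact: top_1. Qed.
Let o1v i : o i _{1} v = h i *: v. Proof. exact: top_1. Qed.
Let o2u i : o i _{2} u = 0. Proof. exact: top_2. Qed.
Let o3u i : o i _{3} u = 0. Proof. exact: top_2. Qed.

Let uu0 : u _{0} u = (la / 2) *: (o false _{0} v + o true _{0} v).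
Proof.
rewrite (griess_mode0 F) ?uu1; last by case: hu.
by rewrite (frame_omega F) linearZr_LR linearDl /= scalerA; congr (_ *: _); field.
Qed.

(** L^i(0) is commuted past [u _{1}]; all terms but the wanted one are known multiples of [v]. The
    same device gives [conf00_self3]. *)
Lemma conf0_self2 i : (o i _{0} u) _{2} u = (- h i * la) *: v.
Proof.
have := mode_comm1 (o i) u u 1.
rewrite !o1u linearZr_LR linearZl_LR uu1 linearZr_LR o1v /= !scalerA.
move=> /esym /(canRL (addKr _)) /(canRL (addrK _)) ->.
by rewrite -!(scaleNr _ v) -!scalerDl; congr (_ *: _); ring.
Qed.

Lemma conf00_self3 i k :
  (o i _{0} (o k _{0} u)) _{3} u = (h i * (h k + (i == k)%:R) * la) *: v.
Proof.
have := mode_comm1 (o i) (o k _{0} u) u 2.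
rewrite conf_10_top // o1u linearZr_LR linearZl_LR conf0_self2 linearZr_LR o1v /= !scalerA.
move=> /esym /(canRL (addKr _)) /(canRL (addrK _)) ->.
rewrite -!(scaleNr _ v) -!scalerDl; congr (_ *: _).
by case: eqP => [->|_] /=; ring.
Qed.

Let h0 k : 2 * h k != 0.
Proof. by case: k; rewrite /top_weight !mulf_neq0 ?invr_eq0 ?pnatr_eq0. Qed.

Lemma conf0_self1 i : (o i _{0} u) _{1} u =
  ((1 - h i) / 2 * la) *: o i _{0} v + (- h i / 2 * la) *: o (~~ i) _{0} v.
Proof.
have hX : homog (- j) 3 ((o i _{0} u) _{1} u).
  by have := hprod 1 (homog_conf_mode i 0 hu) hu.
have [a aE] := homog_top3 Nj_neq0 hX.
have aE' : (o i _{0} u) _{1} u = a i *: o i _{0} v + a (~~ i) *: o (~~ i) _{0} v.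
  by rewrite aE; case: (i) => //; rewrite addrC.
rewrite aE'.
(* L^k(1) isolates [a k], because L^k(1) L^l(-1) v is 2 h_k v for l = k and 0 otherwise. *)
have eq k : 2 * h k * a k = (h k * (h i + (k == i)%:R) - 2 * (h k + (k == i)%:R) * h i
     + (k == i)%:R * 2 * h k) * la.
  apply: (scale_inj v_neq0).
  have := mode_comm2 (o k) (o i _{0} u) u 1.
  rewrite o2u linear0r add0r conf00_self3 conf_10_top // conf_20_top // -/u.
  rewrite !linearZl_LR conf0_self2 uu1 aE' linearDr !linearZr_LR !conf_20_top // -/v.
  rewrite !scalerA -!scalerDl => /(scale_inj v_neq0) e; congr (_ *: _).
  transitivity (a i * (2 * h k * (k == i)%:R) + a (~~ i) * (2 * h k * (k == ~~ i)%:R)).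
    by case: (k); case: (i); rewrite /=; ring.
  by rewrite e; ring.
congr (_ *: _ + _ *: _).
  by apply: (mulfI (h0 i)); rewrite eq eqxx /=; field.
apply: (mulfI (h0 (~~ i))); rewrite eq (_ : (~~ i == i) = false); last by case: (i).
by rewrite /=; field.
Qed.

(** Integration by parts twice: each L(-1) is a derivation of products, and the products on which it
    acts have weight 1 in the piece of [- j], hence vanish. *)
Lemma self3_conf00 i k :
  u _{3} (o i _{0} (o k _{0} u)) = (h k * (h i + (k == i)%:R) * la) *: v.
Proof.
have w1 l : homog j 3 (o l _{0} u) by have := homog_conf_mode l 0 hu.
have e1 : u _{3} (o k _{0} u) = 0.
  by apply: (homog1 (F := F) (j := - j)); have := hprod 3 hu (w1 k).
have e2 : (o i _{0} u) _{3} u = 0.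
  by apply: (homog1 (F := F) (j := - j)); have := hprod 3 (w1 i) hu.
have := mode_comm0 (o i) u (o k _{0} u) 3; rewrite e1 linear0r.
have := mode_comm0 (o k) (o i _{0} u) u 3; rewrite e2 linear0r conf00_self3.
move=> /esym /eqP; rewrite addr_eq0 => /eqP -> /esym /eqP.
by rewrite subr_eq0 => /eqP.
Qed.

Lemma self3_confN1 i : u _{3} (o i _{-1} u) = (2 * h i * la) *: v.
Proof.
have u3 : u _{3} u = 0.
  by apply: (homog_top_lt2 Nj_neq0 (z := 0)) => //; exact: (hprod 3 hu hu).
have := @mode_comm _ _ 2 (o i) u u (-1) 3.
rewrite !big_ord_recl big_ord0 /= u3 linear0r sub0r => e.
have {}e : u _{3} (o i _{-1} u) = - ((o i _{0} u) _{2} u - (o i _{1} u) _{1} u).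
  rewrite -[LHS]opprK; congr (- _); rewrite e; last first.
    by case=> [|[|k]] // _; apply: top_2.
  by rewrite !addr0 !zbinN1 expr0 expr1 scale1r scaleN1r.
rewrite e conf0_self2 o1u linearZl_LR uu1 /= scalerA -scalerBl -scaleNr.
by congr (_ *: _); ring.
Qed.

(** The coefficients are found by computing L^i(1) and L^i(2) of [u _{-1} u] both from the spanning
    list and from the commutator formula. For each factor this gives two equations in [a i] and
    [b i], and a separate one for the mixed coefficient [x]. *)
Lemma selfN1 : u _{-1} u = la *:
  ((- 5 / 8) *: (o false _{0} (o false _{0} v)) + (5 / 4) *: (o false _{-1} v)
      + (1 / 4) *: (o false _{0} (o true _{0} v))
      + ((- 7 / 100) *: (o true _{0} (o true _{0} v)) + (14 / 25) *: (o true _{-1} v))).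
Proof.
have hY : homog (- j) 4 (u _{-1} u) by have := hprod (-1) hu hu.
have [a [b [x YE]]] := homog_top4 Nj_neq0 hY; rewrite YE -/v.
have YE' i : u _{-1} u =
    a i *: o i _{0} (o i _{0} v) + b i *: o i _{-1} v + x *: o i _{0} (o (~~ i) _{0} v)
    + (a (~~ i) *: o (~~ i) _{0} (o (~~ i) _{0} v) + b (~~ i) *: o (~~ i) _{-1} v).
  case: i => //; rewrite YE (conf_comm F false) -/v.
  by rewrite addrC [X in _ + X]addrC addrA.
have N0 (i : bool) : (i == ~~ i) = false by case: i.
have o2Y i : o i _{2} (u _{-1} u) =
    ((4 * h i + 2) * a i + 3 * b i) *: o i _{0} v + (2 * h i * x) *: o (~~ i) _{0} v.
  rewrite (YE' i) !linearDr !linearZr_LR !conf_200_top // !conf_2N_top // -/v.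
  rewrite eqxx N0 /= !mulr1 !mulr0 !mul0r !scale0r !addr0 !scaler0 !addr0.
  rewrite add0r -scalerDl !scalerA -!addrA addrA -scalerDl.
  by congr (_ *: _ + _ *: _); ring.
have o2Y' i : o i _{2} (u _{-1} u) =
    ((1 + h i) / 2 * la) *: o i _{0} v + (h i / 2 * la) *: o (~~ i) _{0} v.
  rewrite mode_comm2 o2u !linear0r linear0l add0r addr0 o1u linearZl_LR uu0 conf0_self1.
  have -> : o false _{0} v + o true _{0} v = o i _{0} v + o (~~ i) _{0} v.
    by case: (i); rewrite // addrC.
  rewrite /= !scalerA scalerDr addrACA -!scalerDl.
  by congr (_ *: _ + _ *: _); field.
have o3Y i : (6 * h i * a i + (4 * h i + c i / 2) * b i) *: v = (2 * h i * la) *: v.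
  have := mode_comm3 (o i) u u (-1).
  rewrite o3u o2u !linear0r !linear0l o1u linearZl_LR uu1 conf0_self2.
  rewrite (YE' i) !linearDr !linearZr_LR !conf_300_top // !conf_3N_top // -/v.
  rewrite eqxx N0 /= !mulr1 !mulr0 !scale0r !scaler0 !addr0 !scalerA add0r.
  rewrite -!(scalerDl v) => /(scale_inj v_neq0) e; congr (_ *: _).
  transitivity (a i * (6 * h i) + b i * (4 * h i + c i / 2)); first by ring.
  by rewrite e; ring.
have eqs i : [/\ (4 * h i + 2) * a i + 3 * b i = (1 + h i) / 2 * la,
    2 * h i * x = h i / 2 * la
  & 6 * h i * a i + (4 * h i + c i / 2) * b i = 2 * h i * la].
  (* The two vectors L(-1) v are not known to be independent, so a further L(1) of the factor
     concerned is applied before comparing coefficients. *)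
  split; last exact: (scale_inj v_neq0 (o3Y i)).
    apply: (mulfI (h0 i)); apply: (scale_inj v_neq0).
    have := congr1 (fun y => o i _{2} y) (etrans (esym (o2Y i)) (o2Y' i)).
    rewrite !linearDr !linearZr_LR !conf_20_top // -/v eqxx N0 /= !mulr1 !mulr0.
    by rewrite !scale0r !scaler0 !addr0 !scalerA ![_ * (2 * h i)]mulrC.
  apply: (mulfI (h0 (~~ i))); apply: (scale_inj v_neq0).
  have := congr1 (fun y => o (~~ i) _{2} y) (etrans (esym (o2Y i)) (o2Y' i)).
  rewrite !linearDr !linearZr_LR !conf_20_top // -/v eqxx [_ == i]eq_sym N0 /= !mulr1 !mulr0.
  by rewrite !scale0r !scaler0 !add0r !scalerA ![_ * (2 * h (~~ i))]mulrC.
have [e1 ex e2] := eqs false; have [e3 _ e4] := eqs true.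
rewrite /top_weight /charge in e1 ex e2 e3 e4.
have nat0 (n : nat) : (n.+1%:R : R[i]) != 0 by rewrite pnatr_eq0.
(* Cramer's rule: the determinants of the two systems are 104/45 and 1150/63, scaled here by 45 and
   63. As [nat0] speaks of successors, it receives 103 and 1149. *)
have aF : a false = - 5 / 8 * la.
  apply: (mulfI (nat0 103%N)).
  transitivity (((4 * (2 / 3) + 2) * a false + 3 * b false) * 138
     - (6 * (2 / 3) * a false + (4 * (2 / 3) + 4 / 5 / 2) * b false) * 135); first by field.
  by rewrite e1 e2; field.
have bF : b false = 5 / 4 * la.
  apply: (mulfI (nat0 103%N)).
  transitivity ((6 * (2 / 3) * a false + (4 * (2 / 3) + 4 / 5 / 2) * b false) * 210
     - ((4 * (2 / 3) + 2) * a false + 3 * b false) * 180); first by field.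
  by rewrite e1 e2; field.
have aT : a true = - 7 / 100 * la.
  apply: (mulfI (nat0 1149%N)).
  transitivity (((4 * (4 / 3) + 2) * a true + 3 * b true) * 363
     - (6 * (4 / 3) * a true + (4 * (4 / 3) + 6 / 7 / 2) * b true) * 189); first by field.
  by rewrite e3 e4; field.
have bT : b true = 14 / 25 * la.
  apply: (mulfI (nat0 1149%N)).
  transitivity ((6 * (4 / 3) * a true + (4 * (4 / 3) + 6 / 7 / 2) * b true) * 462
     - ((4 * (4 / 3) + 2) * a true + 3 * b true) * 504); first by field.
  by rewrite e3 e4; field.
have xv : x = 1 / 4 * la.
  by apply: (mulfI (h0 false)); rewrite /top_weight ex; field.
rewrite aF bF aT bT xv !scalerDr !scalerA.
by rewrite ![_ * la]mulrC.
Qed.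

End SelfProduct.

(** * Products of opposite top vectors and the relation between [la] and [mu] *)

Section StructureConstants.
Variables (R : realType) (U : voa R) (F : frame U).
Local Notation o := (conf F).
Local Notation w := (top F).
Local Notation homog := (homog F).
Local Notation h := (top_weight R).

Variable j : 'Z_3.
Hypothesis j_neq0 : j != 0.
Let u := w j.
Let v := w (- j).
Let Nj_neq0 : - j != 0. Proof. by rewrite oppr_eq0. Qed.
Let hu : homog j 2 u. Proof. exact: top_homog. Qed.
Let hv : homog (- j) 2 v. Proof. exact: top_homog. Qed.

Let wu : weight 2 u. Proof. by case: hu. Qed.
Let wv : weight 2 v. Proof. by case: hv. Qed.

Let o1u i : o i _{1} u = h i *: u. Proof. exact: top_1. Qed.
Let o2u i : o i _{2} u = 0. Proof. exact: top_2. Qed.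
Let o3u i : o i _{3} u = 0. Proof. exact: top_2. Qed.
Let o1v i : o i _{1} v = h i *: v. Proof. exact: top_1. Qed.
Let o2v i : o i _{2} v = 0. Proof. exact: top_2. Qed.
Let o3v i : o i _{3} v = 0. Proof. exact: top_2. Qed.

Variable s : R[i].
Hypothesis vu3 : v _{3} u = s *: vac U.

(** L^i(2) sends the product to h_i s times the vacuum and sends [o i] to c_i / 2 times the vacuum,
    so the coefficients are 2 h_i s / c_i. *)
Lemma opposite_product : v _{1} u = s *: ((5 / 3) *: o false + (28 / 9) *: o true).
Proof.
have hX : homog 0 2 (v _{1} u) by have := homog_mode 1 hv hu; rewrite addNr.
have [a [b XE]] := homog02 hX; rewrite XE.
have vac0 := vac_neq0 F.
have e2 i : (o i _{0} v) _{4} u = (- 2 * h i * s) *: vac U.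
  have := mode_comm2 (o i) v u 2.
  rewrite (griess_mode2 F wv wu) o2u o2v o1v.
  rewrite !linear0r linear0l addr0 add0r linearZl_LR vu3 => /esym /eqP.
  by rewrite addr_eq0 => /eqP ->; rewrite /= !scalerA -scaleNr; congr (_ *: _); ring.
have e3 i : o i _{3} (v _{1} u) = (h i * s) *: vac U.
  rewrite mode_comm3 o3u o2v o3v o1v linear0r !linear0l scaler0 !addr0 add0r e2.
  by rewrite linearZl_LR vu3 /= !scalerA -scalerDl; congr (_ *: _); ring.
have := e3 false; have := e3 true; rewrite XE !linearDr !linearZr_LR.
rewrite (conf_neq F true 3) (conf_neq F false 3) !conf_3 !scaler0 add0r addr0 !scalerA.
move=> /(scale_inj vac0) eb /(scale_inj vac0) ea.
rewrite scalerDr !scalerA; congr (_ *: _ + _ *: _).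
  have -> : a = (a * (4 / 5 / 2)) * (5 / 2) by field.
  by rewrite [a * _]ea /=; field.
have -> : b = (b * (6 / 7 / 2)) * (7 / 3) by field.
by rewrite [b * _]eb /=; field.
Qed.

Variables la mu : R[i].
Hypothesis uu1 : u _{1} u = la *: v.
Hypothesis vv1 : v _{1} v = mu *: u.

Let vv1' : v _{1} v = mu *: w (- - j). Proof. by rewrite opprK. Qed.

(* Compute v _{3} u _{-1} u both from the commutator formula and from the
   expansion of u _{-1} u in Virasoro descendants of v. *)
Lemma self_product_constants : la * mu = 400 / 81 * s.
Proof.
have u_neq0 : u != 0 by apply: top_neq0.
have e1 : v _{3} (u _{-1} u) = (247 / 100 * (la * mu)) *: u.
  rewrite (selfN1 j_neq0 uu1) linearZr_LR !linearDr !linearZr_LR -/v.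
  rewrite !(self3_conf00 Nj_neq0 vv1') !(self3_confN1 Nj_neq0 vv1') opprK -/u.
  rewrite !scalerA -!(scalerDl u) scalerA; congr (_ *: _).
  by rewrite /top_weight /=; field.
(* 142/27 is 5/3 * 2/3 + 28/9 * 4/3, the eigenvalue of the zero modes on [u]. *)
have A1 : (v _{1} u) _{1} u = (142 / 27 * s) *: u.
  rewrite opposite_product linearZl_LR linearDl !linearZl_LR !o1u /= !scalerA.
  by rewrite -scalerDl scalerA; congr (_ *: _); rewrite /top_weight; field.
have A2 : u _{1} (v _{1} u) = (142 / 27 * s) *: u.
  rewrite -A1; apply: (griess_sym1 F) => //.
  by have [] := homog_mode 1 hv hu.
have B : (v _{0} u) _{2} u = (la * mu - 284 / 27 * s) *: u.
  have := mode_comm1 v u u 1.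
  rewrite A1 A2 uu1 linearZr_LR vv1 scalerA.
  move=> /esym /(canRL (addKr _)) /(canRL (addrK _)) ->.
  by rewrite -!(scaleNr _ u) -!(scalerDl u); congr (_ *: _); field.
have e2 : v _{3} (u _{-1} u) = (la * mu + (142 / 27 + 2) * s) *: u.
  rewrite mode_comm3 vu3 (griess_mode2 F wv wu) linear0l.
  rewrite linearZr_LR linearZl_LR voa_vac eqxx (voa_creation _).1 scaler0 addr0.
  rewrite [_ _{-1 + 3} u]B [_ _{-1 + 2} u]A1 scalerA -!(scalerDl u).
  by congr (_ *: _); field.
have : 247 / 100 * (la * mu) = la * mu + (142 / 27 + 2) * s.
  by apply: (scale_inj u_neq0); rewrite -e1.
(* The comparison reads 147/100 la mu = 196/27 s. *)
move=> e; have -> : la * mu = (247 / 100 * (la * mu) - la * mu) * (100 / 147) by field.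
by rewrite {1}e; field.
Qed.

End StructureConstants.

(** * The two conformal vectors of central charge 1/2 *)

Section Generators.
Variables (R : realType) (U : voa R) (F : frame U).
Local Notation o := (conf F).
Local Notation G := (piece F).
Local Notation w := (top F).
Local Notation h := (top_weight R).

Lemma top_normalization : exists (u v : U) (a b : R[i]),
  [/\ a != 0 /\ u = a *: w 1, b != 0 /\ v = b *: w (- 1),
      u _{1} u = (20 / 9) *: v, v _{1} v = (20 / 9) *: u & v _{3} u = vac U].
Proof.
have j0 : (1 : 'Z_3) != 0 by [].
have Nj0 : (- 1 : 'Z_3) != 0 by [].
have hu := top_homog F j0; have hv := top_homog F Nj0.
have [s sE] : exists s, w (- 1) _{3} w 1 = s *: vac U.
  by apply: (griess_mode3 F); [case: hv|case: hu].
have s0 : s != 0.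
  by have := top_pairing_neq0 F j0; apply: contra_neq => s0; rewrite sE s0 scale0r.
have [la laE] := self_product F j0.
have [mu muE] := self_product F Nj0; rewrite opprK in muE.
have lamu := self_product_constants j0 sE laE muE.
have la0 : la != 0.
  apply: contra_eq_neq lamu => ->; rewrite mul0r eq_sym !mulf_neq0 ?invr_eq0 ?pnatr_eq0 //.
(* Scaling the first vector by t and the second by 1 / (t s) makes the pairing 1. The first product
   then has constant t^3 s la, which fixes t^3; the second constant follows from the value of la
   mu. *)
pose t := 3.-root (20 / (9 * s * la)).
have t3 : t ^+ 3 = 20 / (9 * s * la) by rewrite rootCK.
have t0 : t != 0.
  by have := expf_eq0 t 3; rewrite t3 /= => <-; rewrite !mulf_neq0 ?invr_eq0 ?mulf_neq0 ?pnatr_eq0.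
exists (t *: w 1), ((t * s)^-1 *: w (- 1)), t, (t * s)^-1.
have ts0 : t * s != 0 by rewrite mulf_neq0.
split; rewrite ?invr_eq0 // !linearZl_LR !linearZr_LR /= ?laE ?muE ?sE !scalerA.
- congr (_ *: _); transitivity (t ^+ 3 * s * la * (t * s)^-1); first by field; rewrite s0 t0.
  by rewrite t3; field; rewrite t0 s0 la0.
- congr (_ *: _); transitivity ((t ^+ 3)^-1 * (la * mu) * t / (s ^+ 2 * la)).
    by field; rewrite s0 t0 la0.
  by rewrite t3 lamu; field; rewrite s0 la0.
- by rewrite -[RHS]scale1r; congr (_ *: _); field; rewrite t0 s0.
Qed.

Variables u v : U.
Variables a b : R[i].
Hypotheses (a_neq0 : a != 0) (uE : u = a *: w 1).
Hypotheses (b_neq0 : b != 0) (vE : v = b *: w (- 1)).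
Hypotheses (uu1 : u _{1} u = (20 / 9) *: v) (vv1 : v _{1} v = (20 / 9) *: u).
Hypothesis vu3 : v _{3} u = vac U.

Definition comb (p q r t : R[i]) : U :=
  p *: o false + q *: o true + (r *: u + t *: v).

Lemma combD p q r t p' q' r' t' :
  comb p q r t + comb p' q' r' t' = comb (p + p') (q + q') (r + r') (t + t').
Proof.
rewrite /comb addrACA [X in X + _]addrACA [X in _ + X]addrACA.
by rewrite !scalerDl.
Qed.

Lemma combZ k p q r t : k *: comb p q r t = comb (k * p) (k * q) (k * r) (k * t).
Proof. by rewrite /comb !scalerDr !scalerA. Qed.

Let j0 : (1 : 'Z_3) != 0. Proof. by []. Qed.
Let Nj0 : (- 1 : 'Z_3) != 0. Proof. by []. Qed.
Let hu : homog F 1 2 u.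
Proof. by rewrite uE; apply: (subspaceZ _ (homog_subspace _ _ _)); apply: top_homog. Qed.
Let hv : homog F (- 1) 2 v.
Proof. by rewrite vE; apply: (subspaceZ _ (homog_subspace _ _ _)); apply: top_homog. Qed.
Let wu : weight 2 u. Proof. by case: hu. Qed.
Let wv : weight 2 v. Proof. by case: hv. Qed.
Let wo i : weight 2 (o i). Proof. exact: conf_1_weight. Qed.

Lemma comb_weight p q r t : weight 2 (comb p q r t).
Proof.
by do 3?[apply: (subspaceD (weight_subspace U 2))];
  apply: (subspaceZ _ (weight_subspace U 2)).
Qed.

Let ou1 i : o i _{1} u = h i *: u.
Proof. by rewrite uE linearZr_LR /= top_1 // !scalerA mulrC. Qed.
Let ov1 i : o i _{1} v = h i *: v.
Proof. by rewrite vE linearZr_LR /= top_1 // !scalerA mulrC. Qed.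
Let ou3 i : o i _{3} u = 0.
Proof. by rewrite uE linearZr_LR /= top_2 // scaler0. Qed.
Let ov3 i : o i _{3} v = 0.
Proof. by rewrite vE linearZr_LR /= top_2 // scaler0. Qed.

Let vu1 : v _{1} u = (5 / 3) *: o false + (28 / 9) *: o true.
Proof.
have [s sE] : exists s, w (- 1) _{3} w 1 = s *: vac U.
  by apply: (griess_mode3 F); [case: (top_homog F Nj0)|case: (top_homog F j0)].
have := opposite_product j0 sE; rewrite vE uE linearZl_LR linearZr_LR /= => ->.
move: vu3; rewrite vE uE linearZl_LR linearZr_LR /= sE !scalerA => abs.
have -> : b * a * s = 1; last by rewrite scale1r.
by apply: (scale_inj (vac_neq0 F)); rewrite abs scale1r.
Qed.

Let uu3 : u _{3} u = 0.
Proof. exact: (homog_top_lt2 (F := F) (j := 1 + 1) (z := 0)) (homog_mode 3 hu hu). Qed.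
Let vv3 : v _{3} v = 0.
Proof. exact: (homog_top_lt2 (F := F) (j := - 1 - 1) (z := 0)) (homog_mode 3 hv hv). Qed.

Let conf0E : o false = comb 1 0 0 0.
Proof. by rewrite /comb !scale0r !addr0 scale1r. Qed.
Let conf1E : o true = comb 0 1 0 0.
Proof. by rewrite /comb !scale0r !addr0 add0r scale1r. Qed.
Let top1E : u = comb 0 0 1 0.
Proof. by rewrite /comb !scale0r addr0 add0r addr0 scale1r. Qed.
Let top2E : v = comb 0 0 0 1.
Proof. by rewrite /comb !scale0r addr0 !add0r scale1r. Qed.

Lemma comb_product p q r t p' q' r' t' :
  comb p q r t _{1} comb p' q' r' t' =
  comb (2 * (p * p') + 5 / 3 * (r * t' + t * r'))
       (2 * (q * q') + 28 / 9 * (r * t' + t * r'))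
       (2 / 3 * (p * r' + r * p') + 4 / 3 * (q * r' + r * q') + 20 / 9 * (t * t'))
       (2 / 3 * (p * t' + t * p') + 4 / 3 * (q * t' + t * q') + 20 / 9 * (r * r')).
Proof.
rewrite {1 2}/comb !linearDl !linearDr !linearZl_LR !linearZr_LR /=.
rewrite !conf_1 (conf_neq F true 1) (conf_neq F false 1) !ou1 !ov1.
rewrite !(griess_sym1 F (wo _) wu) !(griess_sym1 F (wo _) wv) (griess_sym1 F wv wu).
rewrite !ou1 !ov1 uu1 vv1 vu1.
have -> : (5 / 3) *: o false + (28 / 9) *: o true = comb (5 / 3) (28 / 9) 0 0.
  by rewrite /comb !scale0r !addr0.
rewrite !scaler0 conf0E conf1E top1E top2E !combZ ?add0r ?addr0 !combD /top_weight.
by congr (comb _ _ _ _); field.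
Qed.

Lemma comb_pairing p q r t p' q' r' t' :
  comb p q r t _{3} comb p' q' r' t' =
  (2 / 5 * (p * p') + 3 / 7 * (q * q') + (r * t' + t * r')) *: vac U.
Proof.
rewrite /comb !linearDl !linearDr !linearZl_LR !linearZr_LR /=.
rewrite !conf_3 (conf_neq F true 3) (conf_neq F false 3) !ou3 !ov3.
rewrite !(griess_sym3 F (wo _) wu) !(griess_sym3 F (wo _) wv) (griess_sym3 F wv wu).
rewrite !ou3 !ov3 uu3 vv3 vu3 !scaler0 ?add0r ?addr0 !scalerA -!scalerDl.
by congr (_ *: _); rewrite /charge; field.
Qed.

Lemma comb_conformal p q r t (x := comb p q r t) (k : R[i]) :
  x _{1} x = 2 *: x -> x _{3} x = (k / 2) *: vac U -> conformal_vector k x.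
Proof.
have wx : weight 2 x by apply: comb_weight.
move=> x1 x3; split=> //; apply: virasoro_of_products => //.
- by rewrite (griess_mode0 F wx) x1 linearZr_LR scalerA -[RHS]scale1r; congr (_ *: _); field.
- exact: griess_mode2.
- by move=> n n4; apply: (griess_mode4 F) => //; lia.
Qed.

(** Here [z] is meant to be a cube root of unity and [y] its square. *)
Definition ising (z y : R[i]) : U := comb (5 / 32) (7 / 16) (9 / 32 * z) (9 / 32 * y).

Lemma ising_conformal z y : z * z = y -> y * y = z -> z * y = 1 ->
  conformal_vector (1 / 2) (ising z y).
Proof.
move=> zz yy zy; apply: comb_conformal.
  rewrite comb_product combZ.
  have m x x' : 9 / 32 * x * (9 / 32 * x') = 81 / 1024 * (x * x') :> R[i] by field.
  by rewrite !m zz yy [y * z]mulrC zy; congr (comb _ _ _ _); field.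
rewrite comb_pairing; congr (_ *: _).
have -> : 9 / 32 * z * (9 / 32 * y) = 81 / 1024 * (z * y) :> R[i] by field.
have -> : 9 / 32 * y * (9 / 32 * z) = 81 / 1024 * (z * y) :> R[i] by field.
by rewrite zy; field.
Qed.

Lemma comb_L1 p q r t : virL 1 (comb p q r t) = 0.
Proof.
apply: (weight1 F); have := mode_weight 2 (_ : weight 2 (omega U)) (comb_weight p q r t).
apply; rewrite (frame_omega F).
by apply: (subspaceD (weight_subspace U 2)); apply: wo.
Qed.

(** Invariance is applied to x = x_(-1) 1. Since L(1) maps U_2 into U_1 = 0, only the term [i = 0]
    remains, and it is the pairing of the vacuum with [x _{3} y]. *)
Lemma comb_inner_product p q r t p' q' r' t' (k : R[i]) :
  comb p q r t _{3} comb p' q' r' t' = k *: vac U ->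
  inner_product_is (comb p q r t) (comb p' q' r' t') k.
Proof.
set x := comb p q r t; set y := comb p' q' r' t' => xy; split=> // B Binv B1.
have := Binv 2 (-1) x (vac U) y (comb_weight _ _ _ _).
rewrite (voa_creation x).1 => ->; rewrite (@fsbig_single _ _ _ 0%N).
  rewrite xy linearZr_LR /= B1 fact0 divr1 mulr1.
  by rewrite -exprnP sqrrN expr1n mul1r.
case=> // i _; rewrite iterSr comb_L1.
have -> : iter i (@virL R U 1) 0 = 0.
  by elim: i => //= i ->; rewrite /virL linear0r.
by rewrite linear0l linear0r mulr0.
Qed.

Lemma Z3_cases (j k : 'Z_3) : j != 0 -> [\/ k = 0, k = j | k = - j].
Proof.
case: j k => [[|[|[|//]]] ij] [[|[|[|//]]] ik] // _;
  by [apply: Or31; apply/val_inj|apply: Or32; apply/val_inj|apply: Or33; apply/val_inj].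
Qed.

(* The pieces of j and -j together with their products span a submodule. *)
Lemma pieces_generate (j : 'Z_3) (P : set U) : j != 0 -> is_vertex_subalgebra P ->
  G j `<=` P -> G (- j) `<=` P -> P = setT.
Proof.
move=> jn0 [sP _ mP] jP NjP.
pose side k := k = j \/ k = - j.
have sideN k : side k -> side (- k) by case=> ->; [right|left; rewrite opprK].
have side_neq0 k : side k -> k != 0 by case=> ->; rewrite ?oppr_eq0.
have sP' k : side k -> G k `<=` P by case=> ->.
pose T (x : U) := (exists k, side k /\ G k x) \/
  exists k a b n, [/\ side k, G k a, G (- k) b & x = a _{n} b].
pose S : set U := lspan T.
have sS : subspace S by apply: lspan_subspace.
have TG k x : side k -> G k x -> S x by move=> sk Gx; apply: sub_lspan; left; exists k.
have TM k a' b' n : side k -> G k a' -> G (- k) b' -> S (a' _{n} b').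
  by move=> sk Ga Gb; apply: sub_lspan; right; exists k, a', b', n.
have full y : S y.
  apply: (@submodule_full _ _ F _ (w j)) => //; last 2 first.
  - exact: top_neq0.
  - move=> d n {}y Sy; apply: (voa_ind (F := F) (P := [set d | S (d _{n} y)])).
      exact: (subspace_preim (mode_linearl _ _) sS).
    move=> k z {}d [Gd _] /=.
    apply: (Sy [set y | S (d _{n} y)]).
      exact: (subspace_preim (mode_linear _ _) sS).
    move=> x [[l [sl Gx]]|[l [a' [b' [m [sl Ga Gb ->]]]]]] /=.
      have [kl|kl|kl] := Z3_cases k (side_neq0 l sl); rewrite kl in Gd.
      + by apply: (TG l) => //; rewrite -[l]add0r; apply: piece_mode.
      + by apply: (TG (- l)); [apply: sideN|rewrite -Z3_double; apply: piece_mode].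
      + by apply: (TM (- l)); [apply: sideN| |rewrite opprK].
    (* A product of elements of opposite pieces lies in U^0. An operator from U^0 is moved inside by
       the commutator formula, and one from a nonzero piece sends the product back into that
       piece. *)
    have [k0|kl|kl] := Z3_cases k (side_neq0 l sl).
    + rewrite {}k0 in Gd; have [N HN] := mode_truncN d a' 0.
      have HN' (i : nat) : (N <= i)%N -> d _{i%:Z} a' = 0.
        by move=> /HN; rewrite add0r.
      have /(canRL (subrK _)) -> := mode_comm b' n m HN'.
      apply: (subspaceD sS).
        apply: subspace_sum => // i _; apply: (subspaceZ _ sS).
        by apply: (TM l) => //; rewrite -[l]add0r; apply: piece_mode.
      by apply: (TM l) => //; rewrite -[- l]add0r; apply: piece_mode.
    + apply: (TG k); first by rewrite kl.
      by rewrite -[k]addr0 -(subrr l); do 2?apply: piece_mode.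
    + apply: (TG k); first by rewrite kl; apply: sideN.
      by rewrite -[k]addr0 -(subrr l); do 2?apply: piece_mode.
  - by apply: (TG j); [left|apply: top_piece].
apply/seteqP; split=> // x _; apply: (lspan_min sP _ (full x)).
move=> y [[k [sk Gy]]|[k [a' [b' [n [sk Ga Gb ->]]]]]]; first exact: (sP' k).
by apply: mP; [apply: (sP' k)|apply: (sP' (- k)) => //; apply: sideN].
Qed.

Lemma ising_generate z y : 1 + z + y = 0 -> z * z = y -> y * y = z -> z * y = 1 ->
  z != y -> generated_by [set ising 1 1; ising z y].
Proof.
move=> zy0 zz yy zy z_neq_y P subP SP.
have [sP _ mP] := subP.
have Pe : P (ising 1 1) by apply: SP; left.
have Pf : P (ising z y) by apply: SP; right.
have yE : y = - 1 - z by rewrite -[y]subr0 -zy0; ring.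
(* Because 1 + z + y = 0, the [u], [v] part of the product of the generators is 1/16 of that of
   their sum, so 16 times the product minus the sum involves only the two Virasoro vectors. *)
have PC : P (comb (- 5) 4 0 0).
  have -> : comb (- 5) 4 0 0 =
      (64 / 21) *: (16 *: (ising 1 1 _{1} ising z y) + ((- 1) *: ising 1 1 + (- 1) *: ising z y)).
    rewrite /ising comb_product !combZ !combD !combZ yE.
    by congr (comb _ _ _ _); field.
  apply: (subspaceZ _ sP); apply: (subspaceD sP).
    by apply: (subspaceZ _ sP); apply: mP.
  by apply: (subspaceD sP); apply: (subspaceZ _ sP).
(* The vector just found multiplies both [u] and [v] by -5 * 2/3 + 4 * 4/3 = 2, so subtracting twice
   the generator removes them again and leaves an independent combination. *)
have PD : P (comb (- 5) 7 0 0).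
  have -> : comb (- 5) 7 0 0 =
      (8 / 3) *: (comb (- 5) 4 0 0 _{1} ising 1 1 + (- 2) *: ising 1 1).
    rewrite /ising comb_product !combZ !combD !combZ.
    by congr (comb _ _ _ _); field.
  apply: (subspaceZ _ sP); apply: (subspaceD sP); first exact: mP.
  exact: (subspaceZ _ sP).
have P2 : P (o true).
  have -> : o true = (1 / 3) *: (comb (- 5) 7 0 0 + (- 1) *: comb (- 5) 4 0 0).
    by rewrite conf1E !combZ !combD combZ; congr (comb _ _ _ _); field.
  apply: (subspaceZ _ sP); apply: (subspaceD sP) => //; exact: (subspaceZ _ sP).
have P1 : P (o false).
  have -> : o false = (- 1 / 5) *: (comb (- 5) 4 0 0 + (- 4) *: comb 0 1 0 0).
    by rewrite conf0E !combZ !combD combZ; congr (comb _ _ _ _); field.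
  apply: (subspaceZ _ sP); apply: (subspaceD sP) => //; apply: (subspaceZ _ sP).
  by rewrite -conf1E.
have Po i : P (o i) by case: i.
have Puv z' y' : P (ising z' y') -> P (comb 0 0 z' y').
  move=> Pzy; have -> : comb 0 0 z' y' =
      (32 / 9) *: (ising z' y' + ((- 5 / 32) *: comb 1 0 0 0 + (- 7 / 16) *: comb 0 1 0 0)).
    by rewrite !combZ !combD combZ; congr (comb _ _ _ _); field.
  apply: (subspaceZ _ sP); apply: (subspaceD sP) => //.
  by apply: (subspaceD sP); apply: (subspaceZ _ sP); rewrite -?conf0E -?conf1E.
have P11 := Puv _ _ Pe; have Pzy := Puv _ _ Pf.
have zy_neq0 : z - y != 0 by rewrite subr_eq0.
have Pu : P u.
  have -> : u = (z - y)^-1 *: (comb 0 0 z y + (- y) *: comb 0 0 1 1).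
    by rewrite top1E !combZ !combD combZ; congr (comb _ _ _ _); field.
  apply: (subspaceZ _ sP); apply: (subspaceD sP) => //; exact: (subspaceZ _ sP).
have Pv : P v.
  have -> : v = (z - y)^-1 *: ((- 1) *: comb 0 0 z y + z *: comb 0 0 1 1).
    by rewrite top2E !combZ !combD combZ; congr (comb _ _ _ _); field.
  by apply: (subspaceZ _ sP); apply: (subspaceD sP); apply: (subspaceZ _ sP).
have Pw1 : P (w 1).
  have -> : w 1 = a^-1 *: u by rewrite uE scalerA mulVf // scale1r.
  exact: (subspaceZ _ sP).
have Pw2 : P (w (- 1)).
  have -> : w (- 1) = b^-1 *: v by rewrite vE scalerA mulVf // scale1r.
  exact: (subspaceZ _ sP).
by apply: (pieces_generate j0 subP); apply: top_gen => // i n x Px; apply: mP.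
Qed.

End Generators.

Lemma cube_root_of_unity (R : realType) : exists z y : R[i],
  [/\ 1 + z + y = 0, z * z = y, y * y = z, z * y = 1 & z != y].
Proof.
pose s : R[i] := sqrtC (- 3).
have s2 : s * s = - 3 by rewrite -expr2 sqrtCK.
exists ((- 1 + s) / 2), ((- 1 - s) / 2); split.
- by field.
- transitivity ((1 - 2 * s + s * s) / 4); first by field.
  by rewrite s2; field.
- transitivity ((1 + 2 * s + s * s) / 4); first by field.
  by rewrite s2; field.
- transitivity ((1 - s * s) / 4); first by field.
  by rewrite s2; field.
rewrite -subr_eq0; have -> : (- 1 + s) / 2 - (- 1 - s) / 2 = s by field.
by apply: contra_eq_neq s2 => ->; rewrite mul0r eq_sym oppr_eq0 pnatr_eq0.
Qed.

Lemma frame_generators (R : realType) (U : voa R) (F : frame U) :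
  exists e f : U,
    [/\ conformal_vector (1 / 2) e, conformal_vector (1 / 2) f,
        inner_product_is e f (13 / 2 ^+ 10) & generated_by [set e; f]].
Proof.
have [u [v [a [b [[a0 uE] [b0 vE] uu vv vu]]]]] := top_normalization F.
have [z [y [zy0 zz yy zy z_neq_y]]] := cube_root_of_unity R.
exists (ising F u v 1 1), (ising F u v z y); split.
- by apply: (ising_conformal (F := F) uE vE uu vv vu); rewrite mulr1.
- exact: (ising_conformal (F := F) uE vE uu vv vu).
- apply: (comb_inner_product uE vE).
  rewrite (comb_pairing uE vE vu); congr (_ *: _).
  (* The pairing is (10 + 84 + 81 (z + y)) / 1024 with z + y = -1. *)
  have -> : y = - 1 - z by rewrite -[y]subr0 -zy0; ring.
  by field.
exact: (ising_generate a0 uE b0 vE uu vv vu).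
Qed.

(** * Tensor products of highest weight modules *)

Section HighestWeight.
Variables (K : numFieldType) (V : lmodType K) (c h : K) (L : int -> V -> V).
Hypothesis L_Lch : is_Lch c h L.

Lemma Lch_generated v : v != 0 -> forall P : set V, subspace P ->
  (forall n x, P x -> P (L n x)) -> P v -> forall x, P x.
Proof.
move=> v0 P sP LP Pv x; case: L_Lch => _ _ [_ /(_ P sP LP)] [PE|->] // _.
by move: Pv v0; rewrite PE => /= ->; rewrite eqxx.
Qed.

(** Degree zero descendants of [v] are its multiples, so [graded_coordinate] applies with L(0). The
    functional serves to show that a tensor product of highest weight vectors is nonzero. *)
Lemma Lch_functional v : v != 0 -> L 0 v = h *: v ->
  (forall n, 0 < n -> L n v = 0) ->
  exists f : V -> K, f v = 1 /\ forall a x y, f (a *: x + y) = a * f x + f y.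
Proof.
move=> v0 L0v Lnv; have [L_lin L_vir _ _] := L_Lch.
pose B (z : int) (x : V) := z = 0 /\ x = v.
pose L' (_ : unit) := L.
have B_ge0 z x : B z x -> 0 <= z by case=> ->.
have B_prim z x (i : unit) : B z x ->
    (exists a : K, L' i 0 x = a *: x) /\ forall n, 0 < n -> L' i n x = 0.
  by case=> _ ->; split=> //; exists h.
have L'_lin i n : linear (L' i n) by exact: L_lin.
have L'_rel i j m n x : exists a b : K, L' i m (L' j n x) =
    L' j n (L' i m x) + a *: L' i (m + n) x + (if m + n == 0 then b else 0) *: x.
  exists (m - n)%:~R, ((m ^+ 3 - m)%:~R / 12 * c).
  rewrite /L'; have /(canRL (subrK _)) -> := L_vir m n x.
  by rewrite [LHS]addrC addrA; case: ifP; rewrite ?scale0r.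
apply: (@graded_coordinate _ _ (L 0) (L_lin 0) (descendant L' B) (fun z => h + z%:~R)) => //.
- exact: descendant_subspace.
- by move=> z x; apply: (descendant_neg L'_lin).
- apply: (descendant_eigen L'_lin (L_lin 0)).
    move=> i n x; have /(canRL (subrK _)) := L_vir 0 n x.
    rewrite /L' => ->; rewrite !add0r oppr0 !mul0r scale0r if_same addr0.
    by rewrite [LHS]addrC rmorphN scaleNr.
  by move=> z x [-> ->]; rewrite addr0.
- by move=> z z' /addrI /intr_inj.
- move=> x Dx; pose S (z : int) := if z == 0 then [:: v] else [::].
  have [||c' ->] := @descendant_fspan _ _ _ _ B L'_lin S 0 _ _ 0 x Dx (lexx _).
  + by move=> z y [-> ->] _; apply: mem_fspan; rewrite inE.
  + by move=> i z m y m0 zm; rewrite /S; case: eqP => //; lia.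
  by exists (c' 0%N); rewrite big_ord1.
- exact: desc_base.
- move=> x; apply: (descendant_span L'_lin L'_rel B_prim (Q := setT)) => //.
  move=> P sP LP BP y _; apply: (Lch_generated v0 sP) => //.
    by move=> n z; apply: (LP tt).
  exact: (BP 0).
Qed.

End HighestWeight.

Lemma tensor_generated (K : fieldType) (A B T : lmodType K) (t : {bilinear A -> B -> T})
    (LA : int -> A -> A) (LB : int -> B -> B) (SA : set A) (SB : set B) (P : set T) :
  is_tensor_product t ->
  (forall Q : set A, subspace Q -> (forall n x, Q x -> Q (LA n x)) ->
     SA `<=` Q -> forall x, Q x) ->
  (forall Q : set B, subspace Q -> (forall n x, Q x -> Q (LB n x)) ->
     SB `<=` Q -> forall x, Q x) ->
  subspace P ->
  (forall n a b, P (t a b) -> P (t (LA n a) b)) ->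
  (forall n a b, P (t a b) -> P (t a (LB n b))) ->
  (forall a b, SA a -> SB b -> P (t a b)) -> forall x, P x.
Proof.
move=> ht genA genB sP PA PB PS; apply: (tensor_product_spanned ht sP) => a b.
have rlin x : linear (t x) by move=> k y z; rewrite linearPr.
have llin y : linear (t^~ y) by move=> k x z; rewrite linearPl.
apply: (genB [set b | P (t a b)]) => [|n y|y Sy] /=.
- exact: (subspace_preim (rlin a)).
- exact: PB.
apply: (genA [set a | P (t a y)]) => [|n x|x Sx] /=.
- exact: (subspace_preim (llin y)).
- exact: PA.
exact: PS.
Qed.

(** The bilinear map f(u) g(v) factors through the tensor product and takes the value 1 on the pure
    tensor. *)
Lemma tensor_neq0 (K : fieldType) (A B T : lmodType K) (t : {bilinear A -> B -> T})
    (f : A -> K) (g : B -> K) x y :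
  is_tensor_product t ->
  (forall a u v, f (a *: u + v) = a * f u + f v) ->
  (forall a u v, g (a *: u + v) = a * g u + g v) ->
  f x = 1 -> g y = 1 -> t x y != 0.
Proof.
move=> ht fl gl fx gy.
pose b (u : A) (v : B) : K^o := f u * g v.
have bl : bilinear_for *:%R *:%R b.
  split=> [v k u u'|u k v v']; rewrite /b.
    by rewrite fl mulrDl -mulrA.
  by rewrite gl mulrDr mulrCA.
pose bpack := bilinear_isBilinear.Build K A B K^o *:%R *:%R b bl.
pose bB : {bilinear A -> B -> K^o} := HB.pack b bpack.
have [G [Gb _]] := ht _ bB.
apply/eqP => txy; have := Gb x y; rewrite txy linear0 /= /b fx gy mulr1.
by move/eqP; rewrite eq_sym oner_eq0.
Qed.

(** * Virasoro vectors and primary generators of the two factors and of their tensor products *)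

Section VirasoroSum.
Variables (R : realType) (W : voa R) (c : R[i]) (k : int).
Hypothesis W_sum : is_Lch_sum c 0 c k%:~R (@virL R W).

(** The central charge is transported from the summands, which tie the modes of [omega] to [c]
    rather than to [vrank W]. *)
Lemma Lch_sum_vir : virasoro_rel c (@virL R W).
Proof.
have [M1 [M2 [L1 [L2 [[l1 v1 _ _] [l2 v2 _ _] [phi [[psi psiK phiK] phiL]]]]]]] := W_sum.
move=> m n v; rewrite -(phiK v); case: (psi v) => x y.
have e r x' y' : virL r (phi (x', y')) = phi (L1 r x', L2 r y') by rewrite -phiL.
rewrite !e.
set b := (m + n == 0); set z := _ / 12 * c.
have -> : (if b then z *: phi (x, y) else 0) = phi (if b then z *: (x, y) else 0).
  by case: b; rewrite ?linearZ ?linear0.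
rewrite -linearB -linearZ -linearD; congr (phi _).
have -> : (if b then z *: (x, y) else 0) =
    (if b then z *: x else 0, if b then z *: y else 0) by case: b.
by congr pair; [apply: v1|apply: v2].
Qed.

Lemma Lch_sum_generators : exists g : bool -> W,
  [/\ forall b, virL 0 (g b) = (if b then k else 0)%:~R *: g b,
      forall b n, 0 < n -> virL n (g b) = 0
    & forall P : set W, subspace P -> (forall n x, P x -> P (virL n x)) ->
        (forall b, P (g b)) -> forall x, P x].
Proof.
have [M1 [M2 [L1 [L2 [h1 h2 [phi [[psi psiK phiK] phiL]]]]]]] := W_sum.
have [_ _ _ [v1 [v1n0 v10 v1n]]] := h1; have [_ _ _ [v2 [v2n0 v20 v2n]]] := h2.
have [l1 _ _ _] := h1; have [l2 _ _ _] := h2.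
exists (fun b => if b then phi (0, v2) else phi (v1, 0)); split.
- case; rewrite -phiL /= -linearZ; congr (phi _).
    by rewrite v20 (linear_fun0 (l1 0)); congr pair; rewrite scaler0.
  by rewrite v10 (linear_fun0 (l2 0)); congr pair; rewrite scaler0.
- case=> n n0; rewrite -phiL /= ?v1n ?v2n // -[RHS](linear0 phi).
    by rewrite (linear_fun0 (l1 n)).
  by rewrite (linear_fun0 (l2 n)).
move=> P sP LP Pg x; rewrite -(phiK x); case: (psi x) => x1 x2.
have -> : phi (x1, x2) = phi (x1, 0) + phi (0, x2).
  by rewrite -linearD; congr (phi _); congr pair; rewrite ?addr0 ?add0r.
apply: (subspaceD sP).
  apply: (Lch_generated h1 v1n0 (P := [set y | P (phi (y, 0))])); last exact: (Pg false).
    apply: (subspace_preim _ sP) => a y z; rewrite -linearP; congr (phi _).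
    by congr pair; rewrite /= ?scaler0 ?addr0.
  move=> n y /(LP n); rewrite -phiL /=.
  by rewrite (linear_fun0 (l2 n)).
apply: (Lch_generated h2 v2n0 (P := [set y | P (phi (0, y))])); last exact: (Pg true).
  apply: (subspace_preim _ sP) => a y z; rewrite -linearP; congr (phi _).
  by congr pair; rewrite /= ?scaler0 ?addr0.
by move=> n y /(LP n); rewrite -phiL /= (linear_fun0 (l1 n)).
Qed.

End VirasoroSum.

(** Apply [L(n), L(-2)] to the vacuum: there L(n) vanishes for n >= -1, and L(-2) creates
    [omega]. *)
Lemma omega_modes (R : realType) (V : voa R) (d : R[i]) : virasoro_rel d (@virL R V) ->
  [/\ omega V _{1} omega V = 2 *: omega V, omega V _{2} omega V = 0,
      omega V _{3} omega V = (d / 2) *: vac V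
    & forall n : nat, (4 <= n)%N -> omega V _{n%:Z} omega V = 0].
Proof.
move=> V_vir.
have Lvac n : - 1 <= n -> virL n (vac V) = 0.
  by move=> n1; rewrite /virL (voa_creation _).2 //; lia.
have LN2 : virL (- 2) (vac V) = omega V by rewrite /virL /= (voa_creation _).1.
have e n : - 1 <= n -> omega V _{n + 1} omega V = (n + 2)%:~R *: virL (n - 2) (vac V)
    + (if n - 2 == 0 then ((n ^+ 3 - n)%:~R / 12 * d) *: vac V else 0).
  move=> n1; have /(canRL (subrK _)) := V_vir n (- 2) (vac V).
  have -> : virL (- 2) (virL n (vac V)) = 0 by rewrite (Lvac n n1) /virL linear0r.
  rewrite LN2 addr0.
  by rewrite opprK.
split.
- by have := e 0 isT; rewrite /= LN2 addr0.
- by have := e 1 isT; rewrite /= Lvac // scaler0 addr0.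
- have := e 2 isT; rewrite /= Lvac // scaler0 add0r => ->; congr (_ *: _).
  by field.
move=> n n4; have := e (n%:Z - 1); rewrite subrK => -> ; last by lia.
by rewrite Lvac ?scaler0 ?add0r ?ifF //; lia.
Qed.

Section TensorModes.
Variables (R : realType) (W N T : voa R) (t0 : {bilinear W -> N -> T}).
Hypothesis t0_voa : is_tensor_voa t0.

Definition tensor_conf (i : bool) : T :=
  if i then t0 (vac W) (omega N) else t0 (omega W) (vac N).

Lemma tensor_omega : omega T = tensor_conf false + tensor_conf true.
Proof. by case: t0_voa => _ _ <-. Qed.

Lemma tensor_modeW (n : int) x y : tensor_conf false _{n} t0 x y = t0 (omega W _{n} x) y.
Proof.
case: t0_voa => _ _ _ ->; rewrite (@fsbig_single _ _ _ n) => [|k kn].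
  by rewrite voa_vac (_ : (n - 1 - n == -1) = true) //; lia.
by rewrite voa_vac ifF ?linear0r //; lia.
Qed.

Lemma tensor_modeN (n : int) x y : tensor_conf true _{n} t0 x y = t0 x (omega N _{n} y).
Proof.
case: t0_voa => _ _ _ ->; rewrite (@fsbig_single _ _ _ (-1)) => [|k kn].
  by rewrite voa_vac eqxx (_ : n - 1 - -1 = n) //; lia.
by rewrite voa_vac (negbTE kn) linear0l.
Qed.

Variables (M : vmodule W) (P : vmodule N) (Q : vmodule T).
Variable s : {bilinear M -> P -> Q}.
Hypothesis s_tensor : is_tensor_module t0 s.

Lemma tensor_module_modeW (n : int) x y :
  mmode Q n (tensor_conf false) (s x y) = s (mmode M n (omega W) x) y.
Proof.
case: s_tensor => _ ->; rewrite (@fsbig_single _ _ _ n) => [|k kn].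
  by rewrite vmod_vac (_ : (n - 1 - n == -1) = true) //; lia.
by rewrite vmod_vac ifF ?linear0r //; lia.
Qed.

Lemma tensor_module_modeN (n : int) x y :
  mmode Q n (tensor_conf true) (s x y) = s x (mmode P n (omega N) y).
Proof.
case: s_tensor => _ ->; rewrite (@fsbig_single _ _ _ (-1)) => [|k kn].
  by rewrite vmod_vac eqxx (_ : n - 1 - -1 = n) //; lia.
by rewrite vmod_vac (negbTE kn) linear0l.
Qed.

Lemma tensor_module_top (c1 h1 c2 h2 : R[i]) :
  is_Lch c1 h1 (@mvirL R W M) -> is_Lch c2 h2 (@mvirL R N P) -> exists x : Q,
  [/\ x != 0,
      forall i : bool, mmode Q 1 (tensor_conf i) x = (if i then h2 else h1) *: x,
      forall (i : bool) n, 1 < n -> mmode Q n (tensor_conf i) x = 0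
    & forall S : set Q, subspace S ->
        (forall i n y, S y -> S (mmode Q n (tensor_conf i) y)) -> S x ->
        forall y, S y].
Proof.
move=> LM LP; have [_ _ _ [x [x0 L0x Lnx]]] := LM; have [_ _ _ [y [y0 L0y Lny]]] := LP.
have [f [fx fl]] := Lch_functional LM x0 L0x Lnx.
have [g [gy gl]] := Lch_functional LP y0 L0y Lny.
have ts := s_tensor.1.
exists (s x y); split.
- exact: (tensor_neq0 ts fl gl fx gy).
- case; rewrite ?tensor_module_modeN ?tensor_module_modeW.
    by move: L0y; rewrite /mvirL add0r => ->; rewrite linearZr_LR.
  by move: L0x; rewrite /mvirL add0r => ->; rewrite linearZl_LR.
- move=> i n n1; have n0 : 0 < n - 1 by lia.
  case: i; rewrite ?tensor_module_modeN ?tensor_module_modeW.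
    by have := Lny _ n0; rewrite /mvirL subrK => ->; rewrite linear0r.
  by have := Lnx _ n0; rewrite /mvirL subrK => ->; rewrite linear0l.
move=> S sS SL Sxy.
apply: (@tensor_generated _ _ _ _ s (@mvirL R W M) (@mvirL R N P) [set x] [set y] S ts) => //.
- by move=> S' sS' SL' Sx'; apply: (Lch_generated LM x0 sS' SL'); apply: Sx'.
- by move=> S' sS' SL' Sy'; apply: (Lch_generated LP y0 sS' SL'); apply: Sy'.
- by move=> n a b Sab; rewrite /mvirL -tensor_module_modeW; apply: SL.
- by move=> n a b Sab; rewrite /mvirL -tensor_module_modeN; apply: SL.
- by move=> a b -> ->.
Qed.

End TensorModes.

(** * Obtaining the frame data from the tensor product and extension hypotheses *)

Section Extension.
Variables (R : realType) (W N : voa R) (T : voa R) (t0 : {bilinear W -> N -> T}).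
Hypothesis (hW : is_W0 W) (hN : is_N0 N) (t0_voa : is_tensor_voa t0).

Local Notation oT := (tensor_conf t0).

Let W_vir : virasoro_rel (4 / 5) (@virL R W).
Proof. exact: (@Lch_sum_vir _ _ _ 3 hW.2). Qed.
Let N_vir : virasoro_rel (6 / 7) (@virL R N).
Proof. exact: (@Lch_sum_vir _ _ _ 5 hN.2). Qed.
Let vacT : vac T = t0 (vac W) (vac N).
Proof. by case: t0_voa. Qed.

Let modeT i n x y : oT i _{n} t0 x y =
  if i then t0 x (omega N _{n} y) else t0 (omega W _{n} x) y.
Proof. by case: i; rewrite ?(tensor_modeN t0_voa) ?(tensor_modeW t0_voa). Qed.

Let mode_vac0 (V : voa R) (x : V) (n : nat) : x _{n%:Z} vac V = 0.
Proof. by apply: (voa_creation _).2. Qed.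

Lemma tensor_conf_neq i (n : nat) : oT i _{n%:Z} oT (~~ i) = 0.
Proof. by case: i; rewrite modeT mode_vac0 ?linear0r ?linear0l. Qed.

Lemma tensor_conf_0 i : oT i _{0} oT i = omega T _{0} oT i.
Proof.
rewrite (tensor_omega t0_voa) linearDl; case: i.
  by rewrite (tensor_conf_neq false 0) add0r.
by rewrite (tensor_conf_neq true 0) addr0.
Qed.

Lemma tensor_conf_products i :
  [/\ oT i _{1} oT i = 2 *: oT i, oT i _{2} oT i = 0,
      oT i _{3} oT i = (charge R i / 2) *: vac T
    & forall n : nat, (4 <= n)%N -> oT i _{n%:Z} oT i = 0].
Proof.
have [w1 w2 w3 w4] := omega_modes W_vir; have [n1 n2 n3 n4] := omega_modes N_vir.
case: i; split=> [|||n n4']; rewrite modeT /=.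
- by rewrite n1 linearZr_LR.
- by rewrite n2 linear0r.
- by rewrite n3 linearZr_LR vacT.
- by rewrite n4 // linear0r.
- by rewrite w1 linearZl_LR.
- by rewrite w2 linear0l.
- by rewrite w3 linearZl_LR vacT.
- by rewrite w4 // linear0l.
Qed.

Lemma tensor_ground : exists g : bool -> bool -> T,
  [/\ forall i b b', oT i _{1} g b b' =
        ((if i then if b' then 5 else 0 else if b then 3 else 0) : int)%:~R *: g b b',
      forall i b b' n, 1 < n -> oT i _{n} g b b' = 0
    & forall S : set T, subspace S ->
        (forall i n x, S x -> S (oT i _{n} x)) -> (forall b b', S (g b b')) ->
        forall x, S x].
Proof.
have [p [p0 pn genp]] := @Lch_sum_generators _ _ _ 3 hW.2.
have [q [q0 qn genq]] := @Lch_sum_generators _ _ _ 5 hN.2.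
exists (fun b b' => t0 (p b) (q b')); split.
- move=> i b b'; rewrite modeT; case: i.
    by have := q0 b'; rewrite /virL add0r => ->; rewrite linearZr_LR.
  by have := p0 b; rewrite /virL add0r => ->; rewrite linearZl_LR.
- move=> i b b' n n1; have n0 : 0 < n - 1 by lia.
  rewrite modeT; case: i.
    by have := qn b' _ n0; rewrite /virL subrK => ->; rewrite linear0r.
  by have := pn b _ n0; rewrite /virL subrK => ->; rewrite linear0l.
move=> S sS SL Sg; have tt : is_tensor_product t0 by case: t0_voa.
apply: (@tensor_generated _ _ _ _ t0 (@virL R W) (@virL R N) (range p) (range q) S tt) => //.
- by move=> S' sS' SL' Sp; apply: genp => // b; apply: Sp; exists b.
- by move=> S' sS' SL' Sq; apply: genq => // b; apply: Sq; exists b.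
- by move=> n a b Sab; rewrite /virL -(tensor_modeW t0_voa); apply: SL.
- by move=> n a b Sab; rewrite /virL -(tensor_modeN t0_voa); apply: SL.
- by move=> _ _ [b _ <-] [b' _ <-].
Qed.

End Extension.

Theorem theorem4p11 (R : realType)
  (W : voa R) (Wp Wm : vmodule W) (hW : is_W0 W)
  (hWpm : is_module_pair (4 / 5) (2 / 3) Wp Wm)
  (N : voa R) (Np Nm : vmodule N) (hN : is_N0 N)
  (hNpm : is_module_pair (6 / 7) (4 / 3) Np Nm)
  (U0 : voa R) (t0 : {bilinear W -> N -> U0}) (ht0 : is_tensor_voa t0)
  (U1 : vmodule U0) (t1 : {bilinear Wp -> Np -> U1})
  (ht1 : is_tensor_module t0 t1)
  (U2 : vmodule U0) (t2 : {bilinear Wm -> Nm -> U2})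
  (ht2 : is_tensor_module t0 t2)
  (U : voa R) (U_simple : voa_simple U) (U_ext : is_Z3_extension U1 U2 U) :
  exists e f : U,
    [/\ conformal_vector (1 / 2) e,
        conformal_vector (1 / 2) f,
        inner_product_is e f (13 / 2 ^+ 10)
      & generated_by [set e; f]].
Proof.
have [g [g1 g2 gen]] := tensor_ground hW hN ht0.
have [[_ LWp] [_ LWm] _] := hWpm; have [[_ LNp] [_ LNm] _] := hNpm.
have [u1 [u1n0 u11 u12 gen1]] := tensor_module_top ht1 LWp LNp.
have [u2 [u2n0 u21 u22 gen2]] := tensor_module_top ht2 LWm LNm.
have [G [i0 [i1 [i2 [Gdir Gmode [inj0 inj1 inj2] [G0 G1 G2]
  [i0vac i0om i0m i1m i2m]]]]]] := U_ext.
pose o i := i0 (tensor_conf t0 i).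
(* The primary generators of U^0 have weights 0, 3, 5 and 8; the one of weight 0 is the ground
   vector. *)
pose lev (b b' : bool) : int := (if b then 3 else 0) + (if b' then 5 else 0).
pose base z x := exists b b', z = lev b b' /\ x = i0 (g b b').
(* The value at j = 0 is arbitrary, since a frame constrains the top vectors only for j != 0. *)
pose top (j : 'Z_3) := if j == 1 then i1 u1 else i2 u2.
have Z3E (j : 'Z_3) : j != 0 -> j = 1 \/ j = 2.
  by case: j => [[|[|[|//]]] ij] // _; [left|right]; apply/val_inj.
have om : omega U = o false + o true by rewrite -i0om (tensor_omega ht0) linearD.
have lin0 (A : lmodType R[i]) (f : {linear A -> U}) : linear f by move=> k x y; rewrite linearP.
have products i := tensor_conf_products hW hN ht0 i.
apply: frame_generators; apply: (@Frame R U o G base (i0 (g false false)) top) => //.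
- by move=> i; rewrite -i0om -!i0m (tensor_conf_0 ht0).
- by move=> i; rewrite -i0m; case: (products i) => ->; rewrite linearZ.
- by move=> i; rewrite -i0m; case: (products i) => _ ->; rewrite linear0.
- by move=> i; rewrite -i0m; case: (products i) => _ _ ->; rewrite linearZ /= i0vac.
- by move=> i n n4; rewrite -i0m; case: (products i) => _ _ _ ->; rewrite ?linear0.
- by move=> i n; rewrite -i0m (tensor_conf_neq ht0) linear0.
- by rewrite G0; exists (vac U0).
- by move=> i; rewrite G0; exists (tensor_conf t0 i).
- by move=> z x [b [b' [_ ->]]]; rewrite G0; exists (g b b').
- move=> z x [b [b' [-> ->]]]; rewrite /weight /virL /= add0r om linearDl -!i0m !g1.
  by rewrite !linearZ /= -scalerDl -rmorphD.
- move=> z x i [b [b' [_ ->]]]; split; last by move=> n n1; rewrite -i0m g2 // linear0.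
  by rewrite -i0m g1 linearZ; eexists.
- by move=> z x [[] [[] [-> ->]]]; [right|right|right|left].
- move=> P sP PL Pb; rewrite G0 => _ [x _ <-].
  apply: (gen [set x | P (i0 x)]) => [|i n y /(PL i n)|b b'] /=.
  + exact: (subspace_preim (lin0 _ i0) sP).
  + by rewrite -i0m.
  + by apply: (Pb (lev b b')); exists b, b'.
- move=> j /Z3E [] ->; rewrite /top /=.
    by rewrite -(linear0 i1); apply: contra_neq u1n0 => /inj1.
  by rewrite -(linear0 i2); apply: contra_neq u2n0 => /inj2.
- by move=> j /Z3E [] ->; rewrite /top /= ?G1 ?G2; [exists u1|exists u2].
- move=> i j /Z3E [] ->; rewrite /top /= -?i1m -?i2m ?u11 ?u21 linearZ /=.
    by congr (_ *: _); case: i.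
  by congr (_ *: _); case: i.
- by move=> i j /Z3E [] -> n n1; rewrite /top /= -?i1m -?i2m ?u12 ?u22 // linear0.
- move=> j /Z3E [] -> P sP PL; rewrite /top /= => Pu; rewrite ?G1 ?G2 => _ [x _ <-].
    apply: (gen1 [set x | P (i1 x)]) => [|i n y /(PL i n)|] //=.
      exact: (subspace_preim (lin0 _ i1) sP).
    by rewrite -i1m.
  apply: (gen2 [set x | P (i2 x)]) => [|i n y /(PL i n)|] //=.
    exact: (subspace_preim (lin0 _ i2) sP).
  by rewrite -i2m.
Qed.
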